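(* Let $p$ and $q$ be two distributions on $[k]$. For any $\epsilon>0$ and any integer $\ell>1$, there is an algorithm that runs in time polynomial in $k^{\ell^2}$ and $2^{\ell^3\log\ell}$ and outputs an $\epsilon$-LDP channel $\mathbf T$ mapping from $[k]$ to $[\ell]$, such that if $N$ denotes the sample complexity of hypothesis testing between $p$ and $q$ when each individual uses the channel $\mathbf T$, then $N\asymp n^*(p,q,\epsilon,\ell)$. In particular, the sample complexity with $\mathbf T$ satisfies $$N\lesssim n^*(p,q,\epsilon)\cdot\left(1+\frac{\log\left(n^*(p,q,\epsilon)\right)}{\ell}\right).$$ The channel $\mathbf T$ may be decomposed as a deterministic threshold channel to a domain of size $2\ell^2$, followed by an $\epsilon$-LDP channel from $[2\ell^2]$ to $[\ell]$.
   Context: $[k]=\{1,\dots,k\}$. The notations $\lesssim,\asymp$ hide universal positive constants. A channel $\mathbf T$ from $\mathcal X$ to a countable set $\mathcal Y$ is a transition kernel $\mathbf T(y,x)=\mathbb P(Y=y\mid X=x)$, also viewed as a stochastic map $Y=\mathbf T(X)$. It is $\epsilon$-LDP if $\mathbf T(y,x)\le e^\epsilon\,\mathbf T(y,x')$ for all $x,x'\in\mathcal X$, $y\in\mathcal Y$. Sample complexity under a set $\mathcal C$ of channels: the smallest $n$ for which there exist a deterministic rule assigning to each user $i\in[n]$ a channel $\mathbf T_i\in\mathcal C$, and a test $\phi$ with values in $\{p,q\}$, such that, when $X_1,\dots,X_n$ are i.i.d. and $Y_i=\mathbf T_i(X_i)$ are generated independently, $$\mathbb P_{(X_1,\dots,X_n)\sim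 p^{\otimes n}}(\phi(Y_1,\dots,Y_n)\ne p)+\mathbb P_{(X_1,\dots,X_n)\sim q^{\otimes n}}(\phi(Y_1,\dots,Y_n)\ne q)\le 0.1.$$ $n^*(p,q,\epsilon)$ is the case where $\mathcal C$ is the set of $\epsilon$-LDP channels from $[k]$ to $\mathbb N$; $n^*(p,q,\epsilon,\ell)$ the case where $\mathcal C$ is the set of $\epsilon$-LDP channels from $[k]$ to $[\ell]$; $N$ is the case $\mathcal C=\{\mathbf T\}$. Threshold channel (with respect to $p,q$): a deterministic channel, viewed as a map $\mathbf T:[k]\to[m]$, such that for every $u,v\in[k]$: if $\frac{p(u)}{q(u)}<\frac{p(v)}{q(v)}$ and $\mathbf T(u)=\mathbf T(v)$, then any $w\in[k]$ with $\frac{p(w)}{q(w)}\in\left(\frac{p(u)}{q(u)},\frac{p(v)}{q(v)}\right)$ satisfies $\mathbf T(w)=\mathbf T(u)=\mathbf T(v)$; likelihood ratios take values in the extended reals. The bit-complexity of linear inequalities is assumed to be bounded. *)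

(* Defs.v *)
From HB Require Import structures.
From mathcomp Require Import all_boot all_order all_algebra.
From mathcomp Require Import all_classical all_reals all_analysis.

Set Implicit Arguments.
Unset Strict Implicit.
Unset Printing Implicit Defensive.
Import Order.TTheory GRing.Theory Num.Theory.
Local Open Scope ring_scope.
Local Open Scope classical_set_scope.

(** * Distributions, channels, sample complexity *)

Definition is_dist (R : realType) (k : nat) (p : 'I_k -> R) : Prop :=
  (forall x, 0 <= p x) /\ \sum_x p x = 1.

(* [T y x] is the probability of the output [y] on the input [x]. *)
Definition is_channel (R : realType) (X : Type) (Y : countType)
    (T : Y -> X -> R) : Prop :=
  (forall y x, 0 <= T y x) /\ (forall x, (\esum_(y in setT) (T y x)%:E = 1)%E).

Definition is_ldp (R : realType) (X : Type) (Y : countType) (eps : R)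
    (T : Y -> X -> R) : Prop :=
  forall x x' y, T y x <= expR eps * T y x'.

Definition ldp_channels (R : realType) (X : Type) (Y : countType) (eps : R) :
    set (Y -> X -> R) :=
  [set T | is_channel T /\ is_ldp eps T].

(* P(Y_1 = y_1, ..., Y_n = y_n) for X_1, ..., X_n i.i.d. of law [p] and
   independently generated Y_i = T_i(X_i). *)
Definition output_pmf (R : realType) (k n : nat) (Y : countType)
    (p : 'I_k -> R) (T : 'I_n -> Y -> 'I_k -> R) (y : {ffun 'I_n -> Y}) : R :=
  \sum_(x : {ffun 'I_n -> 'I_k})
     (\prod_(i < n) p (x i)) * (\prod_(i < n) T i (y i) (x i)).

Definition output_prob (R : realType) (k n : nat) (Y : countType)
    (p : 'I_k -> R) (T : 'I_n -> Y -> 'I_k -> R)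
    (A : set {ffun 'I_n -> Y}) : \bar R :=
  (\esum_(y in A) (output_pmf p T y)%:E)%E.

(* The answers [true] and [false] of the test [phi] are the labels of the
   hypotheses [p] and [q] respectively (so that p = q is not testable). *)
Definition test_error (R : realType) (k n : nat) (Y : countType)
    (p q : 'I_k -> R) (T : 'I_n -> Y -> 'I_k -> R)
    (phi : {ffun 'I_n -> Y} -> bool) : \bar R :=
  (output_prob p T [set y | phi y <> true] +
   output_prob q T [set y | phi y <> false])%E.

Definition testable (R : realType) (k : nat) (Y : countType)
    (C : set (Y -> 'I_k -> R)) (p q : 'I_k -> R) (n : nat) : Prop :=
  exists T : 'I_n -> Y -> 'I_k -> R,
    (forall i, C (T i)) /\
    exists phi : {ffun 'I_n -> Y} -> bool,
      (test_error p q T phi <= (10%:R^-1)%:E)%E.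

(* The smallest [n] such that [testable C p q n], and +oo if there is none. *)
Definition sample_complexity (R : realType) (k : nat) (Y : countType)
    (C : set (Y -> 'I_k -> R)) (p q : 'I_k -> R) : \bar R :=
  ereal_inf [set (n%:R)%:E | n in testable C p q].

Definition nstar (R : realType) (k : nat) (p q : 'I_k -> R) (eps : R) : \bar R :=
  sample_complexity (@ldp_channels R 'I_k nat eps) p q.

Definition nstar_comm (R : realType) (k : nat) (p q : 'I_k -> R) (eps : R)
    (l : nat) : \bar R :=
  sample_complexity (@ldp_channels R 'I_k 'I_l eps) p q.

(** * Threshold channels *)

(* In [\bar R] one has a / 0 = +oo for a > 0, and 0 / 0 = 0. *)
Definition likelihood_ratio (R : realType) (k : nat) (p q : 'I_k -> R)
    (x : 'I_k) : \bar R :=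
  ((p x)%:E / (q x)%:E)%E.

Definition is_threshold (R : realType) (k m : nat) (p q : 'I_k -> R)
    (f : 'I_k -> 'I_m) : Prop :=
  forall u v : 'I_k,
    (likelihood_ratio p q u < likelihood_ratio p q v)%E -> f u = f v ->
    forall w : 'I_k,
      (likelihood_ratio p q u < likelihood_ratio p q w)%E ->
      (likelihood_ratio p q w < likelihood_ratio p q v)%E ->
      f w = f u /\ f w = f v.

(** * Algorithms: a real RAM *)

(* Programs handle finitely many arrays of integers and finitely many arrays of
   reals; an array is designated by a literal number in the program text.
   Integer arithmetic is restricted to + and (truncated) -, so that charging
   unit cost is polynomially equivalent to counting bit operations; the only
   integers allowed to enter real arithmetic are literals, and reals influence
   the integers only through comparisons (there is no rounding).  Arithmetic
   and comparisons of reals are exact and have unit cost: this is the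
   assumption of bounded bit-complexity. *)
Inductive iexp : Type :=
| ICst of nat
| IGet of nat & iexp        (* array, index *)
| IAdd of iexp & iexp
| ISub of iexp & iexp.

Inductive rexp : Type :=
| RCst of nat
| RGet of nat & iexp        (* array, index *)
| RAdd of rexp & rexp
| RSub of rexp & rexp
| RMul of rexp & rexp
| RDiv of rexp & rexp.

Inductive bexp : Type :=
| BILe of iexp & iexp
| BRLe of rexp & rexp
| BNot of bexp
| BAnd of bexp & bexp.

Inductive prog : Type :=
| Skip
| ISet of nat & iexp & iexp (* array, index, value *)
| RSet of nat & iexp & rexp (* array, index, value *)
| Seq of prog & prog
| If of bexp & prog & prog
| While of bexp & prog.

Record state (R : realType) : Type := State {
  imem : nat -> nat -> nat;   (* array, index *)
  rmem : nat -> nat -> R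
}.

Definition update (A : Type) (m : nat -> nat -> A) (a i : nat) (v : A) :
    nat -> nat -> A :=
  fun b j => if (b == a) && (j == i) then v else m b j.

Fixpoint ieval (R : realType) (s : state R) (e : iexp) : nat :=
  match e with
  | ICst n => n
  | IGet a e1 => imem s a (ieval s e1)
  | IAdd e1 e2 => (ieval s e1 + ieval s e2)%N
  | ISub e1 e2 => (ieval s e1 - ieval s e2)%N
  end.

Fixpoint reval (R : realType) (s : state R) (e : rexp) : R :=
  match e with
  | RCst n => n%:R
  | RGet a e1 => rmem s a (ieval s e1)
  | RAdd e1 e2 => reval s e1 + reval s e2
  | RSub e1 e2 => reval s e1 - reval s e2
  | RMul e1 e2 => reval s e1 * reval s e2
  | RDiv e1 e2 => reval s e1 / reval s e2
  end.

Fixpoint beval (R : realType) (s : state R) (b : bexp) : bool :=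
  match b with
  | BILe e1 e2 => (ieval s e1 <= ieval s e2)%N
  | BRLe e1 e2 => reval s e1 <= reval s e2
  | BNot b1 => ~~ beval s b1
  | BAnd b1 b2 => beval s b1 && beval s b2
  end.

(* [exec c s t s']: started in [s], [c] halts in [s'] after [t] steps.  A step
   is an assignment or a test; since the expressions occurring in a given
   program have bounded size, this counts elementary operations up to a
   constant factor depending only on the program. *)
Inductive exec (R : realType) : prog -> state R -> nat -> state R -> Prop :=
| ExecSkip s : exec Skip s 1 s
| ExecISet a i e s :
    exec (ISet a i e) s 1
      (State (update (imem s) a (ieval s i) (ieval s e)) (rmem s))
| ExecRSet a i e s :
    exec (RSet a i e) s 1
      (State (imem s) (update (rmem s) a (ieval s i) (reval s e)))
| ExecSeq c1 c2 s s1 s2 t1 t2 :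
    exec c1 s t1 s1 -> exec c2 s1 t2 s2 -> exec (Seq c1 c2) s (t1 + t2)%N s2
| ExecIfTrue b c1 c2 s s1 t :
    beval s b -> exec c1 s t s1 -> exec (If b c1 c2) s t.+1 s1
| ExecIfFalse b c1 c2 s s1 t :
    ~~ beval s b -> exec c2 s t s1 -> exec (If b c1 c2) s t.+1 s1
| ExecWhileTrue b c s s1 s2 t1 t2 :
    beval s b -> exec c s t1 s1 -> exec (While b c) s1 t2 s2 ->
    exec (While b c) s (t1 + t2).+1 s2
| ExecWhileFalse b c s :
    ~~ beval s b -> exec (While b c) s 1 s.

Definition pad (R : realType) (k : nat) (v : 'I_k -> R) (i : nat) : R :=
  oapp v 0 (insub i).

(* Integer arrays 0 and 1 hold [k] and [l] at index 0.  Real array 0 holds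
   e^eps at index 0 (the privacy parameter enters the linear inequalities only
   through this coefficient), real arrays 1 and 2 hold [p] and [q].  All other
   cells are 0. *)
Definition input_state (R : realType) (k l : nat) (p q : 'I_k -> R) (eps : R) :
    state R :=
  State
    (fun a i => match a, i with 0, 0 => k | 1, 0 => l | _, _ => 0 end)%N
    (fun a i => match a with
                | 0%N => if i is 0%N then expR eps else 0
                | 1%N => pad p i
                | 2%N => pad q i
                | _ => 0
                end).

(* Real array 3, in row-major order. *)
Definition output_channel (R : realType) (k l : nat) (s : state R) :
    'I_l -> 'I_k -> R :=
  fun y x => rmem s 3 (y * k + x)%N.

(* Main.v *)
(* The Hellinger distance is replaced by the triangular discrimination
   LC(P, Q) = sum_y (P(y) - Q(y))^2 / (P(y) + Q(y)), which is comparable to it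
   and rational: n users can test iff n * LC is at least of constant order.

   Write E = e^eps - 1 and let L = min(l, max(2, ceil(e^eps))).  Up to
   universal constants the best eps-LDP channel with l outputs is L-ary
   randomized response composed with a deterministic threshold map [k] -> [L].
   Indeed, with mu = p + q and t = (p - q) / mu, a row m + a(x) of a channel,
   where 0 <= a <= E m, contributes
     max_r sum_x mu(x) a(x) (2 r t(x) - r^2) - 2 m r^2,
   so that LC is a quantization problem: each input is rewarded by
   2 r t - r^2 = t^2 - (t - r)^2 for the centre r to which it is sent, and each
   centre costs 2 m r^2.  Greedily choosing L - 1 of the optimal centres of any
   given channel, each with m = 1 / E, captures a constant fraction of its LC,
   because the average gain of a greedy step, with the weights min(m, 1 / E),
   is proportional to what is still missing.  For fixed centres the best
   assignment sends t to the nearest centre, hence is a threshold map.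

   The algorithm enumerates all threshold maps and keeps the best one.

   For the bound in terms of the unrestricted n*, the outputs of a channel are
   merged according to the sign and the dyadic size of (P - Q) / (P + Q).  Only
   O(1 + log n* ) groups matter, and some block of l consecutive groups keeps a
   fraction 1 / (1 + O(log n* ) / l) of LC. *)
Require Import Defs.
From HB Require Import structures.
From mathcomp Require Import all_boot all_order all_algebra.
From mathcomp Require Import all_classical all_reals all_analysis.
From mathcomp Require Import finmap ring lra zify.

Set Implicit Arguments.
Unset Strict Implicit.
Unset Printing Implicit Defensive.
Import Order.TTheory GRing.Theory Num.Theory.
Local Open Scope ring_scope.
Local Open Scope classical_set_scope.

(** * Testing and triangular discrimination *)

Definition output_law (R : realType) (k : nat) (Y : Type) (p : 'I_k -> R)
    (T : Y -> 'I_k -> R) (y : Y) : R :=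
  \sum_x p x * T y x.

Definition lecam (R : realType) (a b : R) : R := (a - b) ^+ 2 / (a + b).

Lemma lecam_ge0 (R : realType) (a b : R) : 0 <= a -> 0 <= b -> 0 <= lecam a b.
Proof. by move=> a0 b0; rewrite divr_ge0 ?sqr_ge0 ?addr_ge0. Qed.

Lemma lecam_le (R : realType) (a b : R) :
  0 <= a -> 0 <= b -> lecam a b <= a + b.
Proof.
move=> a0 b0; have [s0|s0] := eqVneq (a + b) 0.
  by rewrite /lecam s0 invr0 mulr0.
have s_gt0 : 0 < a + b by rewrite lt_neqAle eq_sym s0 addr_ge0.
by rewrite ler_pdivrMr //; nra.
Qed.

(** * Truncation of countable output alphabets *)

Lemma sum_le_esum (R : realType) (Y : choiceType) (A : set Y) (f : Y -> R)
    (s : seq Y) :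
  uniq s -> (forall y, 0 <= f y) ->
  ((\sum_(y <- s | `[< A y >]) f y)%:E <= \esum_(y in A) (f y)%:E)%E.
Proof.
move=> us f0; apply: esum_ge.
exists [set` [seq y <- s | `[< A y >]]].
  split; first exact: finite_seq.
  by move=> y /=; rewrite mem_filter => /andP[/asboolP].
by rewrite -fsbig_seq ?filter_uniq // big_filter sumEFin.
Qed.

Lemma esum_fin (R : realType) (Y : finType) (A : set Y) (f : Y -> R) :
  (forall y, 0 <= f y) ->
  (\esum_(y in A) (f y)%:E = (\sum_(y | `[< A y >]) f y)%:E)%E.
Proof.
move=> f0; rewrite esum_fset //; first last.
- by move=> i _; rewrite lee_fin.
- exact: finite_finset.

have {1}-> : A = [set` [seq y <- enum Y | `[< A y >]]].
  apply/seteqP; split => y /=; rewrite mem_filter mem_enum andbT.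
    by move=> Ay; apply/asboolP.
  by move=> /asboolP.
rewrite -fsbig_seq ?filter_uniq -?enumT ?enum_uniq //.
by rewrite big_filter sumEFin big_enum_cond.
Qed.

Lemma esum_gt_fset (R : realType) (Y : choiceType) (f : Y -> R) (c : R) :
  (c%:E < \esum_(y in setT) (f y)%:E)%E ->
  exists F : {fset Y}, c < \sum_(y <- F) f y.
Proof.
move=> /ereal_sup_gt[_ [X [finX _] <-]] h.
exists (fset_set X); move: h.
by rewrite fsbig_finite //= sumEFin lte_fin.
Qed.

Lemma ler_sum_subseq (R : realDomainType) (Y : eqType) (f : Y -> R)
    (s1 s2 : seq Y) :
  uniq s1 -> uniq s2 -> {subset s1 <= s2} -> (forall y, 0 <= f y) ->
  \sum_(y <- s1) f y <= \sum_(y <- s2) f y.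
Proof.
move=> u1 u2 s12 f0.
rewrite [leRHS](bigID (mem s1)) /= -[in leRHS]big_filter.
have E : perm_eq s1 [seq y <- s2 | y \in s1].
  apply: uniq_perm => // [|y]; first exact: filter_uniq.
  by rewrite mem_filter; case: (boolP (y \in s1)) => //= /s12.
by rewrite (perm_big _ E) /= lerDl sumr_ge0.
Qed.

(** Each of the finitely many rows has a finite set carrying all but [eta] of its mass, and the
    union of these sets serves all rows at once. *)
Lemma channel_fset (R : realType) (I : finType) (Y : countType)
    (f : I -> Y -> R) (eta : R) :
  (forall i y, 0 <= f i y) ->
  (forall i, (\esum_(y in setT) (f i y)%:E = 1)%E) -> 0 < eta ->
  exists F : {fset Y}, forall i, 1 - eta <= \sum_(y <- F) f i y.
Proof.
move=> f0 f1 eta0.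
have /choice[F hF] : forall i, exists F : {fset Y},
    1 - eta < \sum_(y <- F) f i y.
  by move=> i; apply: esum_gt_fset; rewrite f1 lte_fin; lra.
exists (\bigcup_(i <- enum I) F i)%fset => i.
apply: le_trans (ltW (hF i)) _.
apply: ler_sum_subseq => // y yF.
by apply/bigfcupP; exists i => //; rewrite mem_enum.
Qed.

(** * Converse: a successful test forces one user to discriminate *)

Lemma output_pmf_prod (R : realType) (k n : nat) (Y : countType)
    (p : 'I_k -> R) (T : 'I_n -> Y -> 'I_k -> R) (y : {ffun 'I_n -> Y}) :
  output_pmf p T y = \prod_(i < n) output_law p (T i) (y i).
Proof.
rewrite /output_law bigA_distr_bigA /=; apply: eq_bigr => x _.
by rewrite big_split.
Qed.

Lemma output_law_ge0 (R : realType) (k : nat) (Y : Type) (p : 'I_k -> R)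
    (T : Y -> 'I_k -> R) (y : Y) :
  (forall x, 0 <= p x) -> (forall x, 0 <= T y x) -> 0 <= output_law p T y.
Proof. by move=> p0 T0; apply: sumr_ge0 => x _; rewrite mulr_ge0. Qed.

(** The harmonic mean, a rational lower substitute for the geometric mean in the Hellinger affinity.
    For probability vectors it sums to one minus half the triangular discrimination. *)
Definition harmonic (R : realType) (a b : R) : R := a * b *+ 2 / (a + b).

Lemma harmonic_sqr_le (R : realType) (a b : R) :
  0 <= a -> 0 <= b -> harmonic a b ^+ 2 <= a * b.
Proof.
move=> a0 b0; have [s0|s0] := eqVneq (a + b) 0.
  by rewrite /harmonic s0 invr0 mulr0 expr0n /= mulr_ge0.
have s_gt0 : 0 < a + b by rewrite lt_neqAle eq_sym s0 addr_ge0.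
rewrite /harmonic expr_div_n ler_pdivrMr ?exprn_gt0 // -subr_ge0.
have -> : a * b * (a + b) ^+ 2 - (a * b *+ 2) ^+ 2 = a * b * (a - b) ^+ 2.
  by ring.
by rewrite mulr_ge0 ?sqr_ge0 ?mulr_ge0.
Qed.

Lemma harmonicE (R : realType) (a b : R) :
  0 <= a -> 0 <= b -> harmonic a b = (a + b) / 2 - lecam a b / 2.
Proof.
move=> a0 b0; have [s0|s0] := eqVneq (a + b) 0.
  by rewrite /harmonic /lecam s0 invr0 !mulr0 !mul0r subr0.
by rewrite /harmonic /lecam; field.
Qed.

(* AM-GM for the factors 4 min(a, b) and max(a, b) / 4 of 2 sqrt(a b). *)
Lemma le_min_sqr (R : realType) (a b h : R) :
  0 <= a -> 0 <= b -> h ^+ 2 <= a * b ->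
  h <= 2 * Num.min a b + (a + b) / 8.
Proof.
wlog ab : a b / a <= b => [H a0 b0 hab|a0 b0 hab].
  have [ab|/ltW ba] := leP a b.
    by have := H a b ab a0 b0 hab; rewrite (min_idPl ab).
  have := H b a ba b0 a0.
  by rewrite [b * a]mulrC [b + a]addrC (min_idPl ba); exact.
rewrite (min_idPl ab).
have [h0|h0] := leP h 0; first by lra.
rewrite -(ler_pXn2r (n := 2)) ?nnegrE //; [|lra|lra].
apply: le_trans hab _.
have := sqr_ge0 (4 * a - b / 4); nra.
Qed.

Lemma sum_fset_channel_le1 (R : realType) (X : Type) (Y : countType)
    (T : Y -> X -> R) (F : {fset Y}) (x : X) :
  is_channel T -> \sum_(y <- F) T y x <= 1.
Proof.
move=> [T0 T1]; rewrite -lee_fin -(T1 x).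
apply: le_trans (sum_le_esum setT (fset_uniq F) _) => //.
rewrite lee_fin le_eqVlt; apply/orP; left; apply/eqP.
by apply: eq_bigl => y; apply/esym/asboolP.
Qed.

Lemma sum_output_law (R : realType) (k : nat) (Y : Type) (p : 'I_k -> R)
    (T : Y -> 'I_k -> R) (s : seq Y) :
  \sum_(y <- s) output_law p T y = \sum_x p x * \sum_(y <- s) T y x.
Proof.
by rewrite exchange_big; apply: eq_bigr => x _; rewrite mulr_sumr.
Qed.

Lemma bernoulli_half (R : realFieldType) (n : nat) :
  2^-1 <= (1 - (2 * n%:R)^-1) ^+ n :> R.
Proof.
case: n => [|n]; first by rewrite expr0; lra.
have bern m (x : R) : 0 <= x <= 1 -> 1 - m%:R * x <= (1 - x) ^+ m.
  move=> /andP[x0 x1]; elim: m => [|m IH]; first by rewrite expr0; lra.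
  rewrite exprS -natr1.
  have : (1 - x) * (1 - m%:R * x) <= (1 - x) * (1 - x) ^+ m.
    by apply: ler_wpM2l => //; lra.
  have : 0 <= m%:R * x * x by rewrite !mulr_ge0.
  lra.
have : 1 <= n.+1%:R :> R by rewrite ler1n.
move: (bern n.+1 (2 * n.+1%:R)^-1); set N := n.+1%:R => {}bern N1.
have N0 : N != 0 by rewrite gt_eqF //; lra.
apply: le_trans (bern _).
  by rewrite le_eqVlt; apply/orP; left; apply/eqP; field.
by apply/andP; split; [rewrite invr_ge0; lra|rewrite invf_le1; lra].
Qed.

Lemma sum_ffun_fset (R : realType) (n : nat) (Y : choiceType) (F : {fset Y})
    (h : 'I_n -> Y -> R) :
  \sum_(g : {ffun 'I_n -> F}) \prod_(i < n) h i (val (g i)) =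
  \prod_(i < n) \sum_(y <- F) h i y.
Proof.
by under [RHS]eq_bigr do rewrite big_seq_fsetE /=; rewrite bigA_distr_bigA.
Qed.

(** Whatever the test answers at an output vector, one hypothesis is charged there with at least the
    smaller probability; outputs outside [F] are dropped. *)
Lemma sum_min_le_test_error (R : realType) (k n : nat) (Y : countType)
    (p q : 'I_k -> R) (T : 'I_n -> Y -> 'I_k -> R)
    (phi : {ffun 'I_n -> Y} -> bool) (F : {fset Y}) :
  is_dist p -> is_dist q -> (forall i y x, 0 <= T i y x) ->
  ((\sum_(g : {ffun 'I_n -> F})
      Num.min (\prod_(i < n) output_law p (T i) (val (g i)))
              (\prod_(i < n) output_law q (T i) (val (g i))))%:E
     <= test_error p q T phi)%E.
Proof.
move=> [p0 _] [q0 _] T0.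
pose lift (g : {ffun 'I_n -> F}) : {ffun 'I_n -> Y} := [ffun i => val (g i)].
have lift_inj : injective lift.
  move=> g h /ffunP gh; apply/ffunP => i; apply: val_inj.
  by have := gh i; rewrite !ffunE.
pose s := [seq lift g | g <- enum {ffun 'I_n -> F}].
have us : uniq s by rewrite map_inj_uniq ?enum_uniq.
have pmf0 r : (forall x, 0 <= r x) -> forall y, 0 <= output_pmf r T y.
  move=> r0 y; rewrite output_pmf_prod; apply: prodr_ge0 => i _.
  exact: output_law_ge0.
apply: le_trans (leeD (sum_le_esum _ us (pmf0 _ p0))
                      (sum_le_esum _ us (pmf0 _ q0))).
rewrite -EFinD lee_fin.
have -> : \sum_(g : {ffun 'I_n -> F})
    Num.min (\prod_(i < n) output_law p (T i) (val (g i)))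
            (\prod_(i < n) output_law q (T i) (val (g i))) =
    \sum_(y <- s) Num.min (output_pmf p T y) (output_pmf q T y).
  rewrite big_map big_enum /=; apply: eq_bigr => g _.
  by rewrite !output_pmf_prod; congr Num.min; apply: eq_bigr => i _;
    rewrite ffunE.
rewrite (bigID (fun y => phi y == false)) /=; apply: lerD.
  rewrite (eq_bigl (fun y => `[< phi y <> true >])) => [|y].
    by apply: ler_sum => y _; rewrite ge_min lexx.
  by case: (phi y); apply/esym; [apply: asboolF|apply: asboolT].
rewrite (eq_bigl (fun y => `[< phi y <> false >])) => [|y].
  by apply: ler_sum => y _; rewrite ge_min lexx orbT.
by case: (phi y); apply/esym; [apply: asboolT|apply: asboolF].
Qed.

(** By contraposition: if every user stayed below [1 / (2 n)] on all finite sets, the product of the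
    harmonic affinities would be at least 1/2 by Bernoulli, whereas a small error keeps it at most
    9/20. *)
Lemma testable_lecam (R : realType) (k n : nat) (Y : countType)
    (p q : 'I_k -> R) (T : 'I_n -> Y -> 'I_k -> R)
    (phi : {ffun 'I_n -> Y} -> bool) :
  is_dist p -> is_dist q -> (forall i, is_channel (T i)) ->
  (test_error p q T phi <= (10%:R^-1)%:E)%E ->
  exists (i : 'I_n) (F : {fset Y}),
    (2 * n%:R)^-1 <=
    \sum_(y <- F) lecam (output_law p (T i) y) (output_law q (T i) y).
Proof.
move=> dp dq chT err; apply: contrapT => nex.
have small i (F : {fset Y}) : \sum_(y <- F)
    lecam (output_law p (T i) y) (output_law q (T i) y) < (2 * n%:R)^-1.
  by rewrite ltNge; apply/negP => h; apply: nex; exists i, F.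
have T0 i y x : 0 <= T i y x by have [] := chT i.
have [p0 p1] := dp; have [q0 q1] := dq.
have P0 i y : 0 <= output_law p (T i) y by apply: output_law_ge0.
have Q0 i y : 0 <= output_law q (T i) y by apply: output_law_ge0.
(* Truncation loses at most [1 / (4 n)] and the discrimination another [1 / (4 n)], so each affinity
   is at least [1 - 1 / (2 n)]; [n.+1] keeps the loss positive when [n = 0]. *)
have eta0 : 0 < (4 * n.+1%:R)^-1 :> R by rewrite invr_gt0 mulr_gt0 ?ltr0n.
have [F hF] := @channel_fset R ('I_n * 'I_k)%type Y (fun ix y => T ix.1 y ix.2)
  _ (fun ix y => T0 ix.1 y ix.2) (fun ix => (chT ix.1).2 ix.2) eta0.
have le1 r i : is_dist r -> \sum_(y <- F) output_law r (T i) y <= 1.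
  move=> [r0 r1]; rewrite sum_output_law -r1; apply: ler_sum => x _.
  by rewrite ler_piMr // sum_fset_channel_le1.
have ge1 r i : is_dist r ->
    1 - (4 * n.+1%:R)^-1 <= \sum_(y <- F) output_law r (T i) y.
  move=> [r0 r1]; rewrite sum_output_law.
  have -> : 1 - (4 * n.+1%:R)^-1 = \sum_x r x * (1 - (4 * n.+1%:R)^-1).
    by rewrite -mulr_suml r1 mul1r.
  apply: ler_sum => x _.
  by apply: ler_wpM2l => //; exact: (hF (i, x)).
have lo : 2^-1 <= \prod_(i < n) \sum_(y <- F)
    harmonic (output_law p (T i) y) (output_law q (T i) y).
  apply: le_trans (bernoulli_half R n) _.
  rewrite -[X in _ ^+ X](card_ord n) -prodr_const.
  apply: ler_prod => i _; have n0 : (0 < n)%N by case: (n) i => [[]|].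
  have n1 : 1 <= n%:R :> R by rewrite ler1n.
  apply/andP; split; first by rewrite subr_ge0 invf_le1; lra.
  under eq_bigr do rewrite harmonicE //.
  rewrite big_split /= sumrN -!mulr_suml big_split /=.
  have := small i F; have := ge1 p i dp; have := ge1 q i dq.
  have : (4 * n.+1%:R)^-1 <= (4 * n%:R)^-1 :> R.
    by rewrite lef_pV2 ?posrE ?mulr_gt0 ?ltr0n // ler_pM2l ?ler_nat.
  have nn0 : n%:R != 0 :> R by rewrite gt_eqF //; lra.
  have -> : (4 * n%:R)^-1 = (2 * n%:R)^-1 / 2 :> R by field.
  set A := \sum_(_ <- _) lecam _ _.
  set SP := \sum_(_ <- _) _; set SQ := \sum_(_ <- _) _.
  by move: (4 * _)^-1 (2 * _)^-1 => c d; lra.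
(* 9/20 is [2 * (1 / 10) + (1 + 1) / 8], from [le_min_sqr] at each output vector. *)
have hi : \prod_(i < n) \sum_(y <- F)
    harmonic (output_law p (T i) y) (output_law q (T i) y) <= 9 / 20.
  rewrite -sum_ffun_fset.
  have := le_trans (sum_min_le_test_error phi F dp dq T0) err.
  rewrite lee_fin => hmin.
  have prod1 r : is_dist r -> \sum_(g : {ffun 'I_n -> F})
      \prod_(i < n) output_law r (T i) (val (g i)) <= 1.
    move=> dr; rewrite (sum_ffun_fset F (fun i => output_law r (T i))).
    apply: prodr_ile1 => i _; rewrite le1 // andbT sumr_ge0 // => y _.
    by apply: output_law_ge0 => //; case: dr.
  have := prod1 p dp; have := prod1 q dq; move: hmin.
  set S := \sum_g Num.min _ _; set SP := \sum_g _; set SQ := \sum_g _.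
  move=> hmin hQ hP.
  apply: (@le_trans _ _ (2 * S + (SQ + SP) / 8)); last by lra.
  rewrite /S /SP /SQ mulr_sumr -big_split mulr_suml -big_split /=.
  apply: ler_sum => g _; apply: le_min_sqr.
  - by apply: prodr_ge0.
  - by apply: prodr_ge0.
  rewrite -prodrXl -big_split /=; apply: ler_prod => i _.
  by rewrite sqr_ge0 harmonic_sqr_le.
by have := le_trans lo hi; lra.
Qed.

(* The square of each factor on the right dominates [a i * b i]. *)
Lemma min_prod_le (R : realType) (n : nat) (a b : 'I_n -> R) :
  (forall i, 0 <= a i) -> (forall i, 0 <= b i) ->
  Num.min (\prod_i a i) (\prod_i b i) <=
  \prod_i ((a i + b i) / 2 - lecam (a i) (b i) / 4).
Proof.
move=> a0 b0.
have G i : 0 <= (a i + b i) / 2 - lecam (a i) (b i) / 4 /\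
    a i * b i <= ((a i + b i) / 2 - lecam (a i) (b i) / 4) ^+ 2.
  have := lecam_le (a0 i) (b0 i); have := a0 i; have := b0 i.
  have [s0|s0] := eqVneq (a i + b i) 0.
    rewrite /lecam s0 invr0 mulr0 => *; split; first by lra.
    have -> : a i = 0 by lra.
    by rewrite !mul0r sqr_ge0.
  move=> bi ai le; split; first by lra.
  rewrite -subr_ge0.
  have -> : ((a i + b i) / 2 - lecam (a i) (b i) / 4) ^+ 2 - a i * b i =
      (lecam (a i) (b i) / 4) ^+ 2 by rewrite /lecam; field.
  exact: sqr_ge0.
have A0 : 0 <= \prod_i a i by apply: prodr_ge0.
have B0 : 0 <= \prod_i b i by apply: prodr_ge0.
have G0 : 0 <= \prod_i ((a i + b i) / 2 - lecam (a i) (b i) / 4).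
  by apply: prodr_ge0 => i _; have [] := G i.
have m0 : 0 <= Num.min (\prod_i a i) (\prod_i b i) by rewrite le_min A0.
rewrite -(ler_pXn2r (n := 2)) ?nnegrE //.
apply: (@le_trans _ _ ((\prod_i a i) * (\prod_i b i))).
  by rewrite expr2; apply: ler_pM; rewrite // ge_min lexx ?orbT.
rewrite -prodrXl -big_split /=; apply: ler_prod => i _.
by rewrite mulr_ge0 //=; have [] := G i.
Qed.

(** * Achievability: the likelihood test *)

Lemma sum_channel (R : realType) (X : Type) (Y : finType) (T : Y -> X -> R)
    (x : X) :
  is_channel T -> \sum_y T y x = 1.
Proof.
move=> [T0 T1]; have := T1 x; rewrite esum_fin // => -[<-].
by apply: eq_bigl => y; apply/esym; apply: asboolT.
Qed.

Lemma sum_output_law_fin (R : realType) (k : nat) (Y : finType) (p : 'I_k -> R)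
    (T : Y -> 'I_k -> R) :
  is_dist p -> is_channel T -> \sum_y output_law p T y = 1.
Proof.
move=> [_ p1] chT; rewrite sum_output_law -p1; apply: eq_bigr => x _.
by rewrite sum_channel ?mulr1.
Qed.

(** The likelihood test errs with the smaller probability at each output vector; [min_prod_le]
    bounds this by a product whose sum over output vectors factorizes over the users. *)
Lemma test_error_likelihood (R : realType) (k n l : nat) (p q : 'I_k -> R)
    (T : 'I_n -> 'I_l -> 'I_k -> R) :
  is_dist p -> is_dist q -> (forall i, is_channel (T i)) ->
  exists phi : {ffun 'I_n -> 'I_l} -> bool,
    (test_error p q T phi <=
      (\prod_(i < n) (1 - (\sum_y lecam (output_law p (T i) y)
                                       (output_law q (T i) y)) / 4))%:E)%E.
Proof.
move=> dp dq chT.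
have law0 r i y : is_dist r -> 0 <= output_law r (T i) y.
  by move=> [r0 _]; apply: output_law_ge0 => // x; have [] := chT i.
have pmf0 r : is_dist r -> forall y, 0 <= output_pmf r T y.
  move=> dr y; rewrite output_pmf_prod; apply: prodr_ge0 => i _.
  exact: law0.
exists (fun y => output_pmf q T y <= output_pmf p T y).
rewrite /test_error /output_prob !esum_fin; [|exact: pmf0|exact: pmf0].
rewrite -EFinD lee_fin.
apply: (@le_trans _ _
    (\sum_y Num.min (output_pmf p T y) (output_pmf q T y))).
  rewrite [leRHS](bigID (fun y => output_pmf q T y <= output_pmf p T y)) /=.
  rewrite addrC; apply: lerD; rewrite le_eqVlt; apply/orP; left; apply/eqP.
    apply: eq_big => [y|y /asboolP].
      by case: (_ <= _); [apply: asboolF; apply|apply: asboolT].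
    by case: leP.
  apply: eq_big => [y|y /asboolP].
    by case: (_ <= _); [apply: asboolT|apply: asboolF; apply].
  by case: leP.
have -> : \prod_(i < n) (1 - (\sum_y lecam (output_law p (T i) y)
                                       (output_law q (T i) y)) / 4) =
  \prod_(i < n) \sum_y ((output_law p (T i) y + output_law q (T i) y) / 2 -
    lecam (output_law p (T i) y) (output_law q (T i) y) / 4).
  apply: eq_bigr => i _.
  rewrite big_split /= sumrN -!mulr_suml big_split /= !sum_output_law_fin //.
  by congr (_ - _); field.
rewrite bigA_distr_bigA /=; apply: ler_sum => y _.
by rewrite !output_pmf_prod; apply: min_prod_le => i; exact: law0.
Qed.

Lemma sample_complexity_le (R : realType) (k l : nat) (p q : 'I_k -> R)
    (T : 'I_l -> 'I_k -> R) :
  is_dist p -> is_dist q -> is_channel T ->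
  let d := \sum_y lecam (output_law p T y) (output_law q T y) in
  0 < d -> (sample_complexity [set T] p q <= (38 / d)%:E)%E.
Proof.
move=> dp dq chT d d0.
have law0 r y : is_dist r -> 0 <= output_law r T y.
  by move=> [r0 _]; apply: output_law_ge0 => // x; have [] := chT.
have d2 : d <= 2.
  apply: (@le_trans _ _ (\sum_y (output_law p T y + output_law q T y))).
    by apply: ler_sum => y _; apply: lecam_le; exact: law0.
  by rewrite big_split /= !sum_output_law_fin //; lra.
(* With [n d >= 36], [(1 - d / 4)^n <= 1 / (1 + d / 4)^n <= 1 / (1 + n d / 4) <= 1 / 10]; and
   [n <= 36 / d + 1 <= 38 / d] because [d <= 2]. *)
pose n := (Num.truncn (36 / d)).+1.
have /andP[n1 n2] := truncn_itv (ltW (divr_gt0 (ltr0n R 36) d0)).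
have nd : 36 <= n%:R * d.
  by rewrite -ler_pdivrMr // ltW.
apply: (@le_trans _ _ (n%:R)%:E); last first.
  rewrite lee_fin ler_pdivlMr // /n -natr1 mulrDl mul1r.
  by move: n1; rewrite ler_pdivlMr //; lra.
apply: ereal_inf_lbound; exists n => //.
exists (fun _ => T); split => //.
have [phi hphi] := test_error_likelihood (T := fun _ : 'I_n => T)
  dp dq (fun _ => chT).
exists phi; apply: le_trans hphi _.
rewrite lee_fin prodr_const card_ord -/d.
have bern m (x : R) : 0 <= x -> 1 + m%:R * x <= (1 + x) ^+ m.
  move=> x0; elim: m => [|m IH]; first by rewrite expr0; lra.
  rewrite exprS -natr1.
  have : (1 + x) * (1 + m%:R * x) <= (1 + x) * (1 + x) ^+ m.
    by apply: ler_wpM2l => //; lra.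
  have : 0 <= m%:R * x * x by rewrite !mulr_ge0.
  lra.
have x0 : 0 <= d / 4 by lra.
have := bern n _ x0.
have : (1 - d / 4) ^+ n * (1 + d / 4) ^+ n <= 1.
  by rewrite -exprMn; apply: exprn_ile1; nra.
have : 0 <= (1 - d / 4) ^+ n by apply: exprn_ge0; lra.
move: (_ ^+ n) (_ ^+ n) => a b; nra.
Qed.

(** * Greedy choice of centres *)

Section Greedy.
Variables (R : realType) (k : nat) (p q : 'I_k -> R) (E : R).
Hypotheses (dp : is_dist p) (dq : is_dist q) (E_gt0 : 0 < E).

(** An increasing function of the likelihood ratio that is never infinite; it is 0 where
    [p x = q x = 0]. *)
Definition key (p q : 'I_k -> R) (x : 'I_k) : R := p x / (p x + q x).

Local Notation mu x := (p x + q x).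
Local Notation t x := (2 * key p q x - 1).

Lemma mu_ge0 x : 0 <= mu x.
Proof. by rewrite addr_ge0 // ?dp.1 ?dq.1. Qed.

Lemma mu_key x : mu x * t x = p x - q x.
Proof.
have := dp.1 x; have := dq.1 x; rewrite /key.
have [s0|s0] := eqVneq (p x + q x) 0; last by move=> _ _; field.
by rewrite s0 mul0r => q0 p0; lra.
Qed.

Definition gain (r s : R) : R := 2 * r * s - r ^+ 2.

(** [r] maximizes [2 r (P - Q) - r^2 (P + Q)], with maximum [lecam P Q]. Lowering the row by the
    constant [m] is compensated by [2 m r^2], since [p] and [q] both have total mass 1. *)
Lemma lecam_row (a : 'I_k -> R) (m : R) :
  (forall x, 0 <= a x) ->
  let P := \sum_x p x * a x in let Q := \sum_x q x * a x in
  let r := (P - Q) / (P + Q) in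
  lecam P Q =
  \sum_x mu x * ((a x - m) * gain r (t x)) - 2 * m * r ^+ 2.
Proof.
move=> a0 P Q r.
have P0 : 0 <= P by apply: sumr_ge0 => x _; rewrite mulr_ge0 // dp.1.
have Q0 : 0 <= Q by apply: sumr_ge0 => x _; rewrite mulr_ge0 // dq.1.
have -> : \sum_x mu x * ((a x - m) * gain r (t x)) =
    2 * r * (P - Q) - r ^+ 2 * (P + Q)
    - m * (2 * r * (\sum_x p x - \sum_x q x)
           - r ^+ 2 * (\sum_x p x + \sum_x q x)).
  rewrite /P /Q -!sumrB -!big_split /= !mulr_sumr -!sumrB mulr_sumr -sumrB.
  apply: eq_bigr => x _.
  have -> : mu x * ((a x - m) * gain r (t x)) =
      (a x - m) * (2 * r * (mu x * t x) - r ^+ 2 * mu x) by rewrite /gain; ring.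
  by rewrite mu_key; ring.
rewrite dp.2 dq.2 /lecam.
have [s0|s0] := eqVneq (P + Q) 0; last by rewrite /r; field.
by have -> : r = 0; [rewrite /r s0 invr0 mulr0|rewrite s0 invr0; ring].
Qed.

(** The default 0 is the gain of the centre 0, which is thus always available for free. *)
Definition cover (S : seq R) (x : 'I_k) : R :=
  foldr (fun r c => Num.max (gain r (t x)) c) 0 S.

Definition covered (S : seq R) : R := \sum_x mu x * cover S x.

Definition penalty (S : seq R) : R := 2 / E * \sum_(r <- S) r ^+ 2.

Lemma cover_ge0 S x : 0 <= cover S x.
Proof. by elim: S => //= r S IH; rewrite le_max IH orbT. Qed.

Lemma covered_cons r S :
  covered (r :: S) = covered S +
    \sum_x mu x * Num.max (gain r (t x) - cover S x) 0.
Proof.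
rewrite /covered -big_split /=; apply: eq_bigr => x _.
by rewrite -mulrDr addr_maxr addr0 [cover S x + _]addrC subrK.
Qed.

Lemma penalty_cons r S : penalty (r :: S) = penalty S + 2 / E * r ^+ 2.
Proof. by rewrite /penalty big_cons mulrDr addrC. Qed.

Section Channel.
Variables (l : nat) (T : 'I_l -> 'I_k -> R) (m : 'I_l -> R).
Hypotheses (m_ge0 : forall y, 0 <= m y) (mT : forall y x, m y <= T y x)
  (Tm : forall y x, T y x <= (1 + E) * m y)
  (sumT : forall x, \sum_y T y x <= 1).

Let LC := \sum_y lecam (output_law p T y) (output_law q T y).
(** [kappa] bounds the total excess [\sum_y (T y x - m y)] at any input, and [K / E] the total
    weight in the greedy averaging. *)
Let kappa : R := Num.min 1 E.
Let K : R := Num.min E l%:R.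
Let r y : R := (output_law p T y - output_law q T y) /
               (output_law p T y + output_law q T y).

Lemma T_ge0 y x : 0 <= T y x.
Proof. exact: le_trans (m_ge0 y) (mT y x). Qed.

Lemma sum_m_le1 : \sum_y m y <= 1.
Proof.
have [x _|noX] := pickP 'I_k.
  apply: le_trans (sumT x); apply: ler_sum => y _; exact: mT.
have := dp.2; rewrite big_pred0 // => /eqP; by rewrite eq_sym oner_eq0.
Qed.

(** Average the increments with weights [w y = min (m y) (1 / E)]. The weighted sum is at least
    [(LC - kappa * covered S) / E], which exceeds [LC / (2 E)] by hypothesis, while the weights sum
    to at most [K / E]; so some increment reaches [LC / (2 K)]. *)
Lemma greedy_step S :
  covered S < LC / (2 * kappa) ->
  exists y, LC / (2 * K) <=
    (covered (r y :: S) - penalty (r y :: S)) - (covered S - penalty S).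
Proof.
move=> small; apply: contrapT => nex.
pose G y := (covered (r y :: S) - penalty (r y :: S))
            - (covered S - penalty S).
have Glt y : G y < LC / (2 * K).
  by rewrite ltNge; apply/negP => h; apply: nex; exists y.
pose w y := Num.min (m y) E^-1.
have Ei0 : 0 < E^-1 by rewrite invr_gt0.
have w_ge0 y : 0 <= w y by rewrite le_min m_ge0 ltW.
have wm y : w y <= m y by rewrite ge_min lexx.
have kappa0 : 0 < kappa by rewrite lt_min ltr01.
have LC0 : 0 <= LC.
  apply: sumr_ge0 => y _; apply: lecam_ge0; apply: output_law_ge0 => x;
    by rewrite ?T_ge0 ?dp.1 ?dq.1.
have T1 y x : T y x <= 1.
  apply: le_trans (sumT x); rewrite (bigD1 y) //= lerDl.
  by apply: sumr_ge0 => *; exact: T_ge0.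
have sumw : \sum_y w y <= K / E.
  rewrite /K minr_pMl ?(ltW Ei0) // divff ?gt_eqF // le_min; apply/andP; split.
    by apply: le_trans sum_m_le1; apply: ler_sum.
  rewrite mulr_natl -[X in _ *+ X](card_ord l) -sumr_const.
  by apply: ler_sum => y _; rewrite ge_min lexx orbT.
have suma x : \sum_y (T y x - m y) <= kappa.
  rewrite le_min; apply/andP; split.
    by apply: le_trans (sumT x); apply: ler_sum => y _; rewrite gerBl.
  have := sum_m_le1; rewrite -(ler_pM2l E_gt0) mulr1; apply: le_trans.
  rewrite mulr_sumr; apply: ler_sum => y _; have := Tm y x; lra.
(* The excess divided by [E] fits under [m y] by the privacy ratio and under [1 / E] by
   [T y x <= 1]. *)
have aw y x : E^-1 * (T y x - m y) <= w y.
  rewrite le_min ler_pdivrMl // ler_piMr ?(ltW Ei0) //.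
    by rewrite andbT; have := Tm y x; lra.
  by have := T1 y x; have := m_ge0 y; lra.
have lo : E^-1 * (LC - kappa * covered S) <= \sum_y w y * G y.
  have -> : LC = \sum_x mu x * (\sum_y (T y x - m y) * gain (r y) (t x))
      - \sum_y 2 * m y * r y ^+ 2.
    under [in RHS]eq_bigr do rewrite mulr_sumr.
    rewrite exchange_big -sumrB /=; apply: eq_bigr => y _.
    by rewrite (@lecam_row (T y) (m y)) // => x; exact: T_ge0.
  apply: (@le_trans _ _ (\sum_y (E^-1 *
      (\sum_x mu x * ((T y x - m y) * (gain (r y) (t x) - cover S x)))
      - w y * (2 / E * r y ^+ 2)))); last first.
    apply: ler_sum => y _; rewrite /G covered_cons penalty_cons.
    set C := \sum_x mu x * Num.max _ _.
    have -> : w y * (covered S + C - (penalty S + 2 / E * r y ^+ 2)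
        - (covered S - penalty S)) = w y * C - w y * (2 / E * r y ^+ 2).
      by ring.
    rewrite lerD2r /C !mulr_sumr; apply: ler_sum => x _.
    rewrite !(mulrCA _ (mu x)); apply: ler_wpM2l; first exact: mu_ge0.
    have a0 : 0 <= T y x - m y by rewrite subr_ge0.
    apply: (@le_trans _ _ (E^-1 * (T y x - m y) *
        Num.max (gain (r y) (t x) - cover S x) 0)).
      rewrite -mulrA; apply: ler_wpM2l; first exact: ltW.
      by apply: ler_wpM2l => //; rewrite le_max lexx.
    by apply: ler_wpM2r => //; rewrite le_max lexx orbT.
  rewrite sumrB -mulr_sumr exchange_big /= -addrA mulrDr.
  rewrite (_ : E^-1 * _ + _ = E^-1 * (\sum_x mu x *
      (\sum_y (T y x - m y) * gain (r y) (t x)) - kappa * covered S)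
      - E^-1 * \sum_y 2 * m y * r y ^+ 2); last by ring.
  apply: lerB.
    apply: ler_wpM2l; first exact: ltW.
    rewrite /covered mulr_sumr -sumrB; apply: ler_sum => x _.
    rewrite -mulr_sumr [kappa * _]mulrCA -mulrBr.
    apply: ler_wpM2l; first exact: mu_ge0.
    under [leRHS]eq_bigr do rewrite mulrBr.
    rewrite sumrB lerD2l lerN2 -mulr_suml; apply: ler_wpM2r => //.
    exact: cover_ge0.
  rewrite mulr_sumr; apply: ler_sum => y _.
  have -> : w y * (2 / E * r y ^+ 2) = E^-1 * (2 * w y * r y ^+ 2) by ring.
  apply: ler_wpM2l; first exact: ltW.
  by apply: ler_wpM2r; rewrite ?sqr_ge0 // ler_pM2l.
have l0 : (0 < l)%N.
  rewrite lt0n; apply/eqP => l0; move: small; rewrite /LC.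
  rewrite big1 ?mul0r => [|[y yl] _]; last by exfalso; move: yl; rewrite l0.
  by rewrite ltNge sumr_ge0 // => x _; rewrite mulr_ge0 ?mu_ge0 ?cover_ge0.
have K0 : 0 < K by rewrite lt_min E_gt0 ltr0n.
have hi : \sum_y w y * G y <= E^-1 * (LC / 2).
  apply: (@le_trans _ _ (\sum_y w y * (LC / (2 * K)))).
    by apply: ler_sum => y _; apply: ler_wpM2l => //; exact: ltW.
  rewrite -mulr_suml.
  have -> : E^-1 * (LC / 2) = K / E * (LC / (2 * K)).
    by field; rewrite !gt_eqF.
  by apply: ler_wpM2r => //; rewrite divr_ge0 // ltW // mulr_gt0.
have := le_trans lo hi; rewrite ler_pM2l //.
by move: small; rewrite invfM mulrA ltr_pdivlMr //; lra.
Qed.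

(** Each step adds [LC / (2 K)] to [covered S - penalty S] unless [covered S] is already large. The
    induction tracks the difference because that is what the increments add up to. *)
Lemma greedy n :
  exists S : seq R, [/\ size S = n, penalty S <= covered S &
    LC / (2 * kappa) <= covered S \/ n%:R * (LC / (2 * K)) <= covered S].
Proof.
suff [S [Sn h0 h1]] : exists S : seq R,
    [/\ size S = n, penalty S <= covered S &
    LC / (2 * kappa) <= covered S \/
    n%:R * (LC / (2 * K)) <= covered S - penalty S].
  exists S; split=> //; case: h1 => h1; [by left|right].
  apply: le_trans h1 _; rewrite gerBl mulr_ge0 ?divr_ge0 ?(ltW E_gt0) //.
  by apply: sumr_ge0 => s _; exact: sqr_ge0.
elim: n => [|n [S [Sn h0 h1]]].
  exists [::]; split=> //; rewrite /penalty /covered big_nil mulr0 big1 //.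
  - by move=> x _; rewrite mulr0.
  - by right; rewrite mul0r subr0.
  - by move=> x _; rewrite mulr0.
have [big|small] := leP (LC / (2 * kappa)) (covered S).
  (* Once enough is covered, the list is padded with the centre 0, which costs nothing. *)
  exists (0 :: S); split=> /=; first by rewrite Sn.
    rewrite penalty_cons expr0n mulr0 addr0; apply: le_trans h0 _.
    rewrite covered_cons lerDl sumr_ge0 // => x _.
    by rewrite mulr_ge0 ?mu_ge0 // le_max lexx orbT.
  left; apply: le_trans big _; rewrite covered_cons lerDl sumr_ge0 // => x _.
  by rewrite mulr_ge0 ?mu_ge0 // le_max lexx orbT.
have [y hy] := greedy_step small.
case: h1 => [|h1]; first by rewrite leNgt small.
have d0 : 0 <= LC / (2 * K).
  rewrite divr_ge0 ?mulr_ge0 ?le_min ?(ltW E_gt0) ?ler0n //.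
  apply: sumr_ge0 => z _; apply: lecam_ge0; apply: output_law_ge0 => x;
    by rewrite ?T_ge0 ?dp.1 ?dq.1.
exists (r y :: S); split=> /=; first by rewrite Sn.
  by rewrite -subr_ge0; move: hy h0; lra.
right; rewrite -natr1 mulrDl mul1r; lra.
Qed.

End Channel.

(** [gain (s / 2) t] exceeds [gain s t / 2] by [s^2 / 4]. *)
Lemma cover_half S x : cover S x / 2 <= cover [seq s / 2 | s <- S] x.
Proof.
elim: S => [|s S IH] /=; first by rewrite mul0r.
rewrite maxr_pMl ?invr_ge0 ?ler0n // ge_max !le_max IH orbT andbT.
by apply/orP; left; have := sqr_ge0 s; rewrite /gain; nra.
Qed.

End Greedy.

(** * Threshold maps and randomized response *)

(** For sorted centres, the number of midpoints not above [s] is the index of a nearest centre, and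
    [gain r s = s^2 - (s - r)^2] is largest there. In the induction, an [s] past the last midpoint
    is past all earlier ones. *)
Lemma voronoi (R : realType) (c : nat -> R) (s : R) (M : nat) :
  (forall i, (i < M)%N -> c i <= c i.+1) ->
  forall j, (j <= M)%N ->
  gain (c j) s <= gain (c (\sum_(i < M) ((c i + c i.+1) / 2 <= s)%R)%N) s.
Proof.
elim: M => [|M IH] c_incr j jM.
  by rewrite big_ord0; move: jM; rewrite leqn0 => /eqP ->.
have {}IH := IH (fun i iM => c_incr i (ltnW iM)).
have cM := c_incr M (ltnSn M).
have mono i : (i <= M)%N -> c i <= c M.
  elim: (M) c_incr i => [|m IHm] ci i; first by rewrite leqn0 => /eqP ->.
  rewrite leq_eqVlt ltnS => /predU1P[->//|im].
  by apply: le_trans (ci m _); [apply: IHm => // n nm; exact/ci/ltnW|lia].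
rewrite big_ord_recr /=; have [h|h] := leP ((c M + c M.+1) / 2) s.
  have all1 : (\sum_(i < M) ((c i + c i.+1) / 2 <= s)%R = M)%N.
    rewrite -[RHS]card_ord -sum1_card; apply: eq_bigr => i _.
    suff -> : (c i + c i.+1) / 2 <= s by [].
    have /mono := ltnW (ltn_ord i); have /mono := ltn_ord i; lra.
  rewrite all1 addn1 in IH *.
  have up : gain (c M) s <= gain (c M.+1) s by rewrite /gain; nra.
  move: jM; rewrite leq_eqVlt ltnS => /predU1P[->//|jM].
  exact: le_trans (IH j jM) up.
rewrite addn0; move: jM; rewrite leq_eqVlt ltnS => /predU1P[->|/IH//].
by apply: le_trans (IH M (leqnn M)); rewrite /gain; nra.
Qed.

Definition nat_key (R : realType) (k : nat) (p q : 'I_k -> R) (i : nat) : R :=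
  pad p i / (pad p i + pad q i).

Lemma pad_ord (R : realType) (k : nat) (v : 'I_k -> R) (x : 'I_k) :
  pad v x = v x.
Proof. by rewrite /pad valK. Qed.

Lemma nat_keyE (R : realType) (k : nat) (p q : 'I_k -> R) (x : 'I_k) :
  nat_key p q x = key p q x.
Proof. by rewrite /nat_key !pad_ord. Qed.

(* A digit [d i < k] encodes the threshold [key (d i)], and [d i = k] encodes
   a threshold that no key reaches. *)
Definition label (R : realType) (k : nat) (p q : 'I_k -> R) (M : nat)
    (d : nat -> nat) (x : nat) : nat :=
  (\sum_(i < M) ((d i < k)%N && (nat_key p q (d i) <= nat_key p q x)%R))%N.

Lemma label_le (R : realType) (k : nat) (p q : 'I_k -> R) (M : nat)
    (d : nat -> nat) (x : nat) : (label p q M d x <= M)%N.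
Proof.
by rewrite -[leqRHS]card_ord -sum1_card; apply: leq_sum => i _; case: andb.
Qed.

(** Among the inputs that reach [c], one with the smallest key makes the same cut; the digit [k]
    serves when there is none. *)
Lemma digit_threshold (R : realType) (k : nat) (p q : 'I_k -> R) (c : R) :
  exists2 d : nat, (d <= k)%N & forall x : 'I_k,
    (d < k)%N && (nat_key p q d <= nat_key p q x) = (c <= key p q x).
Proof.
have [x0 cx0|none] := pickP (fun x => c <= key p q x); last first.
  by exists k => // x; rewrite ltnn none.
case: (@Order.TotalTheory.arg_minP _ _ _ x0 (fun x => c <= key p q x)
  (key p q) cx0) => x cx xmin.
exists x => [|y]; first exact: ltnW.
rewrite ltn_ord !nat_keyE /=; apply/idP/idP; first exact: le_trans.
exact: xmin.
Qed.

Definition cell_sum (R : realType) (k : nat) (v : 'I_k -> R) (f : 'I_k -> nat)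
    (j : nat) : R :=
  \sum_(x | f x == j) v x.

(** Up to the factor [E^2 / (L + E)], the triangular discrimination left by [L]-ary randomized
    response on the cells of [f]; see [lecam_rand_resp]. *)
Definition value (R : realType) (k : nat) (p q : 'I_k -> R) (E : R) (L : nat)
    (f : 'I_k -> nat) : R :=
  \sum_(j < L) cell_sum (fun x => p x - q x) f j ^+ 2
    / (2 + E * cell_sum (fun x => p x + q x) f j).

Lemma value_ge0 (R : realType) (k : nat) (p q : 'I_k -> R) (E : R) (L : nat)
    (f : 'I_k -> nat) :
  is_dist p -> is_dist q -> 0 < E -> 0 <= value p q E L f.
Proof.
move=> dp dq E0; apply: sumr_ge0 => j _; rewrite divr_ge0 ?sqr_ge0 //.
rewrite addr_ge0 ?ler0n // mulr_ge0 ?(ltW E0) // sumr_ge0 // => x _.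
by rewrite addr_ge0 ?dp.1 ?dq.1.
Qed.

Lemma sum_cells (R : realType) (k L : nat) (f : 'I_k -> nat)
    (F : 'I_k -> R) :
  (forall x, (f x < L)%N) ->
  \sum_x F x = \sum_(j < L) \sum_(x | f x == j) F x.
Proof.
move=> fL; rewrite (partition_big (fun x => Ordinal (fL x)) xpredT) //=.
Qed.

(** Each cell's term of the value, times [E], is the maximum of reward minus penalty over its
    centre: the difference is a square divided by [E * (2 + E * W)]. *)
Lemma value_ge_centers (R : realType) (k : nat) (p q : 'I_k -> R) (E : R)
    (L : nat) (f : 'I_k -> nat) (c : nat -> R) :
  is_dist p -> is_dist q -> 0 < E -> (forall x, (f x < L)%N) ->
  \sum_x (p x + q x) * gain (c (f x)) (2 * key p q x - 1)
    - 2 / E * \sum_(j < L) c j ^+ 2 <= E * value p q E L f.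
Proof.
move=> dp dq E0 fL.
rewrite (sum_cells _ fL) /value !mulr_sumr -sumrB; apply: ler_sum => j _.
set U := cell_sum _ _ j; set W := cell_sum _ _ j.
have W0 : 0 <= W by apply: sumr_ge0 => x _; rewrite addr_ge0 ?dp.1 ?dq.1.
have -> : \sum_(x | f x == j)
    (p x + q x) * gain (c (f x)) (2 * key p q x - 1) =
    2 * c j * U - c j ^+ 2 * W.
  rewrite /U /W /cell_sum !mulr_sumr -sumrB; apply: eq_bigr => x /eqP ->.
  by rewrite -mu_key // /gain; ring.
have w0 : 0 < 2 + E * W by have := mulr_ge0 (ltW E0) W0; lra.
rewrite -subr_ge0.
have -> : E * (U ^+ 2 / (2 + E * W)) -
    (2 * c j * U - c j ^+ 2 * W - 2 / E * c j ^+ 2) =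
    (E * U - c j * (2 + E * W)) ^+ 2 / (E * (2 + E * W)).
  by field; rewrite !gt_eqF.
by rewrite divr_ge0 ?sqr_ge0 // mulr_ge0 // ltW.
Qed.

(* Halving the centres divides the penalty by 4 but the reward at most by 2,
   so that [penalty <= covered] suffices to keep a constant fraction. *)
Lemma best_threshold_cover (R : realType) (k : nat) (p q : 'I_k -> R) (E : R)
    (S : seq R) :
  is_dist p -> is_dist q -> 0 < E ->
  exists2 d : nat -> nat, (forall i, (d i <= k)%N) &
    covered p q S / 2 - penalty E S / 4 <=
    E * value p q E (size S).+1 (fun x => label p q (size S) d x).
Proof.
move=> dp dq E0; set M := size S.
pose S2 := [seq r / 2 | r <- S].
(* The extra centre 0 realizes the default 0 of [cover]; [M + 1] sorted centres have [M] midpoints,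
   hence [M] thresholds. *)
pose s := sort <=%R (0 :: S2).
have size_s : size s = M.+1 by rewrite size_sort /= size_map.
pose c := nth 0 s.
have c_incr i : (i < M)%N -> c i <= c i.+1.
  move=> iM; apply: (sorted_leq_nth le_trans le_refl) => //.
  - exact/sort_sorted/le_total.
  - by rewrite inE size_s; lia.
  - by rewrite inE size_s; lia.
(* Midpoints live on the scale of [2 * key - 1], hence the change of variable [(c + 1) / 2]. *)
have /choice[d hd] : forall i, exists d : nat, (d <= k)%N /\ forall x : 'I_k,
    (d < k)%N && (nat_key p q d <= nat_key p q x) =
    (((c i + c i.+1) / 2 + 1) / 2 <= key p q x).
  move=> i.
  have [d dk hd] := digit_threshold p q (((c i + c i.+1) / 2 + 1) / 2).
  by exists d.
exists d => [i|]; first by have [] := hd i.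
have labelE (x : 'I_k) : label p q M d x =
    (\sum_(i < M) ((c i + c i.+1) / 2 <= 2 * key p q x - 1)%R)%N.
  apply: eq_bigr => i _; rewrite (hd i).2; congr (nat_of_bool _).
  by apply/idP/idP; lra.
apply: le_trans (value_ge_centers c dp dq E0 _); last first.
  by move=> x; rewrite ltnS label_le.
apply: lerB.
  rewrite /covered mulr_suml; apply: ler_sum => x _.
  rewrite -mulrA; apply: ler_wpM2l; first exact: mu_ge0.
  apply: le_trans (cover_half _ _ _ _) _; rewrite -/S2 labelE.
  have best r : r \in 0 :: S2 -> gain r (2 * key p q x - 1) <=
      gain (c (\sum_(i < M) ((c i + c i.+1) / 2 <= 2 * key p q x - 1)%R)%N)
        (2 * key p q x - 1).
    rewrite -(mem_sort <=%R) -/s => /(nthP 0)[j js <-].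
    by apply: voronoi => //; rewrite size_s in js.
  move: (gain (c _) _) best => B best.
  have B0 : 0 <= B.
    by have := best 0 (mem_head _ _); rewrite /gain mulr0 mul0r expr0n subr0.
  have {}best r : r \in S2 -> gain r (2 * key p q x - 1) <= B.
    by move=> rS; apply: best; rewrite inE rS orbT.
  elim: (S2) best => //= r S' IH best; rewrite ge_max best ?mem_head //=.
  by apply: IH => r' r'S; apply: best; rewrite inE r'S orbT.
rewrite /penalty -[leRHS]mulrA; apply: ler_wpM2l.
  by rewrite divr_ge0 ?(ltW E0).
rewrite -size_s -(big_mkord xpredT (fun j => c j ^+ 2)).
rewrite -(big_nth 0 xpredT (fun r => r ^+ 2)).
rewrite (perm_big (0 :: S2)) ?perm_sort //= big_cons expr0n add0r big_map.
rewrite mulr_suml le_eqVlt; apply/orP; left; apply/eqP.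
by apply: eq_bigr => r _; field.
Qed.

(* The number of outputs is [min(l, max(2, ceil(1 + E)))], where
   [1 + E = e^eps]. *)
Definition level_spec (R : realType) (E : R) (l L : nat) : Prop :=
  [/\ (1 < L)%N, (L <= l)%N, L = l \/ 1 + E <= L%:R
    & L = 2 \/ L%:R < 2 + E].

(** Greedy with [L - 1] centres covers at least [LC / (4 kappa)], a threshold map keeps a quarter of
    this, and [kappa * (L + E) <= 4 * E] turns [16 * kappa * E] into [64 * E^2 / (L + E)]. Rows may
    sum to less than 1, as [quantize] drops outputs. *)
Lemma best_threshold (R : realType) (k l L : nat) (p q : 'I_k -> R) (E : R)
    (T : 'I_l -> 'I_k -> R) :
  is_dist p -> is_dist q -> 0 < E -> level_spec E l L ->
  (forall y x, 0 <= T y x) -> (forall x, \sum_y T y x <= 1) ->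
  (forall x x' y, T y x <= (1 + E) * T y x') ->
  exists2 d : nat -> nat, (forall i, (d i <= k)%N) &
    \sum_y lecam (output_law p T y) (output_law q T y) <=
    64 * (E ^+ 2 / (L%:R + E)
          * value p q E L (fun x => label p q L.-1 d x)).
Proof.
move=> dp dq E0 [L1 Ll Lhi Llo] T0 sumT ldpT.
set LC := \sum_y _.
have LC0 : 0 <= LC.
  apply: sumr_ge0 => y _; apply: lecam_ge0; apply: output_law_ge0 => x;
    by rewrite ?T0 ?dp.1 ?dq.1.
have /choice[m hm] : forall y, exists m, [/\ 0 <= m, forall x, m <= T y x
    & forall x, T y x <= (1 + E) * m].
  move=> y; have [x0 _|noX] := pickP 'I_k; last first.
    by exists 0; split=> // x; have := noX x.
  case: (@Order.TotalTheory.arg_minP _ _ _ x0 xpredT (T y) isT) => x _ xmin.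
  by exists (T y x); split=> // x'; exact: xmin.
have [S [SM pen cov]] := greedy (T := T) (m := m) dp dq E0
  (fun y => let: And3 h _ _ := hm y in h)
  (fun y => let: And3 _ h _ := hm y in h)
  (fun y => let: And3 _ _ h := hm y in h) sumT L.-1.
have [d dk hd] := best_threshold_cover S dp dq E0.
exists d => //; move: hd; rewrite SM prednK ?(ltnW L1) //.
set v := value _ _ _ _ _ => hd.
have {}hd : covered p q S <= 4 * (E * v) by lra.
have L1R : 2 <= L%:R :> R by rewrite ler_nat.
have LlR : L%:R <= l%:R :> R by rewrite ler_nat.
have MR : L.-1%:R = L%:R - 1 :> R.
  by case: (L) L1 => //= n _; rewrite -natr1 addrK.
set kappa : R := Num.min 1 E in cov; set K : R := Num.min E _ in cov.
have kappa0 : 0 < kappa by rewrite lt_min ltr01.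
have kappa1 : kappa <= 1 by rewrite ge_min lexx.
have kappaE : kappa <= E by rewrite ge_min lexx orbT.
have KE : K <= E by rewrite ge_min lexx.
have Kl : K <= l%:R by rewrite ge_min lexx orbT.
have K0 : 0 < K by rewrite lt_min E0 ltr0n (leq_trans _ Ll) // ltnW.
(* For [E >= 1]: [K <= E <= L - 1] if [L >= 1 + E], and [K <= l <= 2 * (l - 1)] if [L = l]. For
   [E < 1], already [K <= E = kappa]. *)
have KL : K <= 2 * kappa * (L%:R - 1).
  rewrite /kappa; have [E1|E1] := leP 1 E; last by nra.
  by case: Lhi => [Lhi|]; [move: Kl; rewrite -Lhi|]; lra.
have cov0 : 0 <= covered p q S.
  apply: sumr_ge0 => x _; apply: mulr_ge0; first exact: mu_ge0.
  exact: cover_ge0.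
have cov4 : LC <= 4 * kappa * covered p q S.
  rewrite -/LC in cov; case: cov => h.
    move: h; rewrite ler_pdivrMr ?mulr_gt0 // => h.
    by have := mulr_ge0 (ltW kappa0) cov0; lra.
  move: h; rewrite MR mulrA ler_pdivrMr ?mulr_gt0 // => h.
  have : (L%:R - 1) * LC <= (L%:R - 1) * (4 * kappa * covered p q S).
    by apply: le_trans h _; nra.
  by rewrite ler_pM2l //; lra.
have v0 : 0 <= v by apply: value_ge0.
apply: (@le_trans _ _ (16 * kappa * (E * v))).
  by apply: le_trans cov4 _; have := ltW kappa0; nra.
have LE0 : 0 < L%:R + E by lra.
have -> : 64 * (E ^+ 2 / (L%:R + E) * v) =
    16 * (4 * E / (L%:R + E)) * (E * v) by field; rewrite gt_eqF.
apply: ler_wpM2r; first by rewrite mulr_ge0 // ltW.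
rewrite ler_pM2l ?ltr0n // ler_pdivlMr //.
by case: Llo => [->|Llo]; nra.
Qed.

(** Outputs from [L] on get probability 0, so that an [L]-ary response is also a channel to [l >= L]
    outputs. *)
Definition rand_resp (R : realType) (E : R) (L y j : nat) : R :=
  if (y < L)%N then (if j == y then 1 + E else 1) / (L%:R + E) else 0.

Lemma rand_resp_ge0 (R : realType) (E : R) (L y j : nat) :
  0 < E -> 0 <= rand_resp E L y j.
Proof.
move=> E0; rewrite /rand_resp; case: ifP => // _.
rewrite divr_ge0 ?addr_ge0 ?ler0n ?(ltW E0) //.
by case: ifP => // _; rewrite addr_ge0 ?(ltW E0).
Qed.

Lemma rand_resp_ldp (R : realType) (E : R) (L y j j' : nat) :
  0 < E -> rand_resp E L y j <= (1 + E) * rand_resp E L y j'.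
Proof.
move=> E0; rewrite /rand_resp; case: ifP => _; last by rewrite mulr0.
rewrite mulrA; apply: ler_wpM2r.
  by rewrite invr_ge0 addr_ge0 ?ler0n ?(ltW E0).
by case: ifP => _; case: ifP => _; nra.
Qed.

Lemma sum_rand_resp (R : realType) (E : R) (l L j : nat) :
  0 < E -> (j < L)%N -> (L <= l)%N -> \sum_(y < l) rand_resp E L y j = 1.
Proof.
move=> E0 jL Ll; rewrite /rand_resp -big_mkcond /=.
rewrite -(big_ord_widen _
  (fun y => (if j == y then 1 + E else 1) / (L%:R + E)) Ll) -mulr_suml.
have -> : \sum_(y < L) (if j == y then 1 + E else 1) = L%:R + E.
  rewrite (bigD1 (Ordinal jL)) //= eqxx (eq_bigr (fun=> 1)) => [|y].
    rewrite sumr_const cardC1 card_ord addrAC; congr (_ + _).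
    by rewrite -[in RHS](ltn_predK jL) -natr1 addrC.
  by rewrite -val_eqE /= eq_sym => /negPf ->.
rewrite divff // gt_eqF // addr_gt0 // ltr0n; exact: leq_ltn_trans jL.
Qed.

Lemma rand_resp_channel (R : realType) (X : Type) (E : R) (l L : nat)
    (f : X -> nat) :
  0 < E -> (forall x, (f x < L)%N) -> (L <= l)%N ->
  is_channel (fun (y : 'I_l) x => rand_resp E L y (f x)).
Proof.
move=> E0 fL Ll; split=> [y x|x]; first exact: rand_resp_ge0.
rewrite esum_fin => [|y]; last exact: rand_resp_ge0.
rewrite -(sum_rand_resp E0 (fL x) Ll); congr EFin.
by apply: eq_bigl => y; apply: asboolT.
Qed.

(** A used output has probability [(1 + E * mass of its cell) / (L + E)]: the 1 cancels in the
    difference and becomes the 2 in the denominators of [value]. *)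
Lemma lecam_rand_resp (R : realType) (k l L : nat) (p q : 'I_k -> R) (E : R)
    (f : 'I_k -> nat) :
  is_dist p -> is_dist q -> 0 < E -> (0 < L)%N -> (L <= l)%N ->
  let T (y : 'I_l) x := rand_resp E L y (f x) in
  \sum_y lecam (output_law p T y) (output_law q T y) =
  E ^+ 2 / (L%:R + E) * value p q E L f.
Proof.
move=> dp dq E0 L0 Ll T.
have LE0 : 0 < L%:R + E by rewrite addr_gt0 // ltr0n.
have law r (y : 'I_l) : is_dist r -> output_law r T y =
    if (y < L)%N then (1 + E * cell_sum r f y) / (L%:R + E) else 0.
  move=> dr; rewrite /output_law /T /rand_resp; case: ifP => _; last first.
    by apply: big1 => x _; rewrite mulr0.
  under eq_bigr do rewrite mulrA; rewrite -mulr_suml; congr (_ / _).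
  transitivity (\sum_x (r x + E * (if f x == y then r x else 0))).
    by apply: eq_bigr => x _; case: ifP => _; ring.
  by rewrite big_split /= dr.2 -mulr_sumr -big_mkcond.
transitivity (\sum_(y < l | (y < L)%N) E ^+ 2 / (L%:R + E) *
  (cell_sum (fun x => p x - q x) f y ^+ 2
    / (2 + E * cell_sum (fun x => p x + q x) f y))).
  rewrite [RHS]big_mkcond; apply: eq_bigr => y _.
  rewrite (law p) // (law q) //; case: ifP => _; last first.
    by rewrite /lecam addr0 invr0 mulr0.
  have Wge0 (r : 'I_k -> R) : is_dist r -> 0 <= cell_sum r f y.
    by move=> dr; apply: sumr_ge0 => x _; rewrite dr.1.
  have -> : cell_sum (fun x => p x - q x) f y = cell_sum p f y - cell_sum q f y.
    by rewrite /cell_sum sumrB.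
  have -> : cell_sum (fun x => p x + q x) f y = cell_sum p f y + cell_sum q f y.
    by rewrite /cell_sum big_split.
  move: (cell_sum p f y) (cell_sum q f y) (Wge0 p dp) (Wge0 q dq) => a b a0 b0.
  have w0 : 2 + E * (a + b) != 0.
    by rewrite gt_eqF // ltr_pwDl // mulr_ge0 ?addr_ge0 ?(ltW E0).
  have -> : lecam ((1 + E * a) / (L%:R + E)) ((1 + E * b) / (L%:R + E)) =
      (E * (a - b) / (L%:R + E)) ^+ 2 / ((2 + E * (a + b)) / (L%:R + E)).
    by rewrite /lecam; congr (_ ^+ 2 / _); ring.
  by field; rewrite w0 gt_eqF.
rewrite -(big_ord_widen _ (fun y => E ^+ 2 / (L%:R + E) *
  (cell_sum (fun x => p x - q x) f y ^+ 2
    / (2 + E * cell_sum (fun x => p x + q x) f y))) Ll).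
by rewrite mulr_sumr.
Qed.

(** * Quantization of the output *)

(** Level [J] is a sink without lower bound, which receives the values too small for the other
    levels. *)
Lemma dyadic_level (R : realType) (s : R) (J : nat) :
  s <= 1 -> exists m : nat, [/\ (m <= J)%N, s <= 2^-1 ^+ m
    & (m < J)%N -> 2^-1 ^+ m / 2 <= s].
Proof.
move=> s1; elim: J => [|J [m [mJ sm hm]]]; first by exists 0%N; rewrite expr0.
move: mJ; rewrite leq_eqVlt => /predU1P[mJ|mJ]; last first.
  by exists m; split=> //; [exact: ltnW (ltnW _)|move=> _; exact: hm].
have [h|/ltW h] := leP s (2^-1 ^+ m / 2).
  by exists m.+1; rewrite exprSr; split=> //; lia.
by exists m; split=> //; lia.
Qed.

(** With normalized differences of one sign between [tau / 2] and [tau], the separate terms are at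
    most [tau^2] times the mass, and the merged term is at least [(tau / 2)^2] times the mass. *)
Lemma lecam_merge (R : realType) (Y : Type) (s : seq Y) (B : pred Y)
    (a b : Y -> R) (tau sigma : R) :
  (forall y, 0 <= a y) -> (forall y, 0 <= b y) -> 0 <= tau ->
  sigma ^+ 2 = 1 ->
  (forall y, B y -> tau / 2 * (a y + b y) <= sigma * (a y - b y)) ->
  (forall y, B y -> sigma * (a y - b y) <= tau * (a y + b y)) ->
  \sum_(y <- s | B y) lecam (a y) (b y) <=
  4 * lecam (\sum_(y <- s | B y) a y) (\sum_(y <- s | B y) b y).
Proof.
move=> a0 b0 tau0 sg lo hi.
set A := \sum_(y <- s | B y) a y; set C := \sum_(y <- s | B y) b y.
have A0 : 0 <= A by apply: sumr_ge0.
have C0 : 0 <= C by apply: sumr_ge0.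
have up : \sum_(y <- s | B y) lecam (a y) (b y) <= tau ^+ 2 * (A + C).
  rewrite /A /C -big_split mulr_sumr /=; apply: ler_sum => y By.
  have [s0|s0] := eqVneq (a y + b y) 0.
    by rewrite /lecam s0 invr0 !mulr0.
  have s_gt0 : 0 < a y + b y by rewrite lt_neqAle eq_sym s0 addr_ge0.
  rewrite ler_pdivrMr //; have := lo y By; have := hi y By.
  have -> : (a y - b y) ^+ 2 = (sigma * (a y - b y)) ^+ 2.
    by rewrite exprMn sg mul1r.
  move: (sigma * _) => u h1 h2.
  have t0 : 0 <= tau * (a y + b y) by rewrite mulr_ge0 // ltW.
  rewrite -mulrA -expr2 -exprMn ler_sqr ?nnegrE //; lra.
apply: le_trans up _.
have [s0|s0] := eqVneq (A + C) 0.
  by rewrite s0 mulr0 mulr_ge0 ?lecam_ge0.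
have s_gt0 : 0 < A + C by rewrite lt_neqAle eq_sym s0 addr_ge0.
rewrite /lecam mulrA ler_pdivlMr //.
have : tau / 2 * (A + C) <= sigma * (A - C).
  by rewrite /A /C -big_split -sumrB !mulr_sumr /=; apply: ler_sum => y /lo.
have -> : (A - C) ^+ 2 = (sigma * (A - C)) ^+ 2 by rewrite exprMn sg mul1r.
move: (sigma * _) => u h.
have t0 : 0 <= tau / 2 * (A + C) by rewrite mulr_ge0 ?divr_ge0 ?(ltW s_gt0).
have : (tau / 2 * (A + C)) ^+ 2 <= u ^+ 2 by rewrite ler_sqr ?nnegrE //; lra.
have -> : (tau / 2 * (A + C)) ^+ 2 = tau ^+ 2 * (A + C) * (A + C) / 4 by field.
lra.
Qed.

Lemma pigeonhole_sum (R : realType) (N : nat) (w : 'I_N -> R) :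
  (0 < N)%N -> exists i, \sum_j w j <= N%:R * w i.
Proof.
move=> N0; apply: contrapT => nex.
have lt i : w i < (\sum_j w j) / N%:R.
  rewrite ltr_pdivlMr ?ltr0n // mulrC ltNge; apply/negP => h.
  by apply: nex; exists i.
have : \sum_j w j < \sum_(j < N) (\sum_j w j) / N%:R.
  by apply: ltr_sum => //; apply/hasP; exists (Ordinal N0);
    rewrite ?mem_index_enum.
rewrite sumr_const card_ord -[ltRHS]mulr_natr divfK ?ltxx //.
by rewrite pnatr_eq0 -lt0n.
Qed.

Lemma trunc_log_ln (R : realType) (n : nat) :
  (0 < n)%N -> (trunc_log 2 n)%:R <= 2 * ln (n%:R : R).
Proof.
move=> n0; have := trunc_logP (ltnSn 1) n0; rewrite -(ler_nat R) natrX.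
have n0R : 0 < n%:R :> R by rewrite ltr0n.
rewrite -ler_ln ?posrE ?exprn_gt0 // lnXn //.
have : 2^-1 <= ln (2 : R).
  have := @le_ln1Dx R (- 2^-1).
  have -> : 1 - 2^-1 = 2^-1 :> R by field.
  by rewrite lnV ?posrE //; lra.
rewrite -(mulr_natr (ln 2)); have : 0 <= (trunc_log 2 n)%:R :> R by [].
by move: (_%:R) (ln _) (ln _) => w u v *; nra.
Qed.

(* Outputs are grouped by sign and dyadic size of the normalized difference
   [(P - Q) / (P + Q)]; merging a group loses at most a factor 4, the groups
   below the precision [2^-J] are negligible, and of the remaining [2 J]
   groups one keeps the best block of [l] consecutive ones. *)
Lemma quantize (R : realType) (k l n : nat) (Y : choiceType)
    (p q : 'I_k -> R) (T : Y -> 'I_k -> R) (s : seq Y) (e : R) :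
  is_dist p -> is_dist q -> (1 < l)%N -> (0 < n)%N ->
  (forall y x, 0 <= T y x) -> (forall x, \sum_(y <- s) T y x <= 1) ->
  (forall x x' y, T y x <= e * T y x') ->
  (2 * n%:R)^-1 <= \sum_(y <- s) lecam (output_law p T y) (output_law q T y) ->
  exists T' : 'I_l -> 'I_k -> R,
    [/\ forall y x, 0 <= T' y x, forall x, \sum_y T' y x <= 1,
        forall x x' y, T' y x <= e * T' y x'
      & (2 * n%:R)^-1 <= 32 * (1 + ln n%:R / l%:R) *
          \sum_y lecam (output_law p T' y) (output_law q T' y)].
Proof.
move=> dp dq l1 n0 T0 sumT ldpT big.
set P := output_law p T in big *; set Q := output_law q T in big *.
have P0 y : 0 <= P y by apply: output_law_ge0 => // x; exact: dp.1.
have Q0 y : 0 <= Q y by apply: output_law_ge0 => // x; exact: dq.1.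
(* [2^J >= 2 n + 2] gives [4^-J <= 1 / (8 n)]: outputs at level [J] contribute at most [1 / (4 n)],
   at most half of the discrimination. *)
pose J := (trunc_log 2 n).+2.
have /choice[lv hlv] : forall y, exists m : nat, [/\ (m <= J)%N,
    `|P y - Q y| <= 2^-1 ^+ m * (P y + Q y) &
    (m < J)%N -> 2^-1 ^+ m / 2 * (P y + Q y) <= `|P y - Q y|].
  move=> y; have [s0|s0] := eqVneq (P y + Q y) 0.
    have [-> ->] : P y = 0 /\ Q y = 0 by have := P0 y; have := Q0 y; lra.
    by exists 0%N; rewrite !(subr0, addr0) normr0 !mulr0; split.
  have s_gt0 : 0 < P y + Q y by rewrite lt_neqAle eq_sym s0 addr_ge0.
  have [|m [mJ h1 h2]] := @dyadic_level R (`|P y - Q y| / (P y + Q y)) J.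
    rewrite ler_pdivrMr // mul1r ler_norml.
    by have := P0 y; have := Q0 y; lra.
  exists m; split=> //; first by rewrite -ler_pdivrMr.
  by rewrite -ler_pdivlMr.
pose sg y : nat := (Q y <= P y)%R.
(* Level and sign are interleaved into one index. Its quotient by [l] is the block and its remainder
   the new output, so a block sends at most one group to each output; [blkE] checks that [inord] is
   faithful below level [J]. *)
pose bk y := ((lv y).*2 + sg y)%N.
pose N := (J.*2 %/ l).+1.
pose blk y : 'I_N := inord (bk y %/ l).
have l0 : (0 < l)%N by exact: ltnW.
pose pos y : 'I_l := Ordinal (ltn_pmod (bk y) l0).
pose LC := \sum_(y <- s) lecam (P y) (Q y).
have sumPQ : \sum_(y <- s) (P y + Q y) <= 2.
  rewrite big_split /=.
  have law1 r : is_dist r -> \sum_(y <- s) output_law r T y <= 1.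
    move=> dr; rewrite sum_output_law -dr.2; apply: ler_sum => x _.
    by rewrite ler_piMr ?dr.1.
  by have := law1 p dp; have := law1 q dq; rewrite -/P -/Q; lra.
have low : \sum_(y <- s | (J <= lv y)%N) lecam (P y) (Q y) <= LC / 2.
  apply: (@le_trans _ _ (\sum_(y <- s | (J <= lv y)%N)
      (4 * n%:R)^-1 / 2 * (P y + Q y))).
    apply: ler_sum => y Jlv; have [lvJ h _] := hlv y.
    have [s0|s0] := eqVneq (P y + Q y) 0.
      by rewrite /lecam s0 invr0 !mulr0.
    have s_gt0 : 0 < P y + Q y by rewrite lt_neqAle eq_sym s0 addr_ge0.
    rewrite ler_pdivrMr // -[leRHS]mulrA -expr2 -real_normK ?num_real //.
    apply: (@le_trans _ _ ((2^-1 ^+ J * (P y + Q y)) ^+ 2)).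
      have lvE : lv y = J by apply/eqP; rewrite eqn_leq lvJ.
      rewrite lvE in h; rewrite ler_sqr ?nnegrE //.
      by rewrite mulr_ge0 ?exprn_ge0 ?invr_ge0 // ltW.
    rewrite exprMn; apply: ler_wpM2r; first exact: sqr_ge0.
    have hJ : (2 * n + 2 <= 2 ^ J)%N.
      by rewrite /J expnS; have := trunc_log_ltn n (ltnSn 1); lia.
    move: hJ; rewrite -(ler_nat R) natrD natrM natrX => hJ.
    have n1 : 1 <= n%:R :> R by rewrite ler1n.
    have nn0 : n%:R != 0 :> R by rewrite pnatr_eq0 -lt0n.
    have -> : (4 * n%:R)^-1 / 2 = (8 * n%:R)^-1 :> R by field.
    rewrite !exprVn lef_pV2 ?posrE ?exprn_gt0 //; last by lra.
    by move: (2 ^+ J) hJ => u hJ; nra.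
  rewrite -mulr_sumr.
  apply: (@le_trans _ _ ((4 * n%:R)^-1 / 2 * 2)).
    apply: ler_wpM2l; first by rewrite divr_ge0 ?invr_ge0 ?mulr_ge0.
    apply: le_trans sumPQ; rewrite [leRHS](bigID (fun y => (J <= lv y)%N)) /=.
    by rewrite lerDl sumr_ge0 // => y _; rewrite addr_ge0.
  have nn0 : n%:R != 0 :> R by rewrite pnatr_eq0 -lt0n.
  have -> : (4 * n%:R)^-1 / 2 * 2 = (2 * n%:R)^-1 / 2 :> R by field.
  by apply: ler_wpM2r => //; rewrite invr_ge0.
have blkE y : (lv y < J)%N -> blk y = (bk y %/ l)%N :> nat.
  move=> lvJ; rewrite inordK // ltnS leq_div2r // /bk /sg.
  by case: (_ <= _); rewrite /= -?muln2; lia.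
have [i hi] := @pigeonhole_sum R N
  (fun i => \sum_(y <- s | (lv y < J)%N && (blk y == i)) lecam (P y) (Q y))
  (ltn0Sn _).
rewrite -(partition_big blk xpredT) //= in hi.
have half : LC / 2 <= \sum_(y <- s | (lv y < J)%N) lecam (P y) (Q y).
  have : LC = \sum_(y <- s | (J <= lv y)%N) lecam (P y) (Q y) +
              \sum_(y <- s | (lv y < J)%N) lecam (P y) (Q y).
    rewrite /LC (bigID (fun y => (J <= lv y)%N)) /=; congr (_ + _).
    by apply: eq_bigl => y; rewrite -ltnNge.
  by move: low; lra.
pose B i j y := [&& (lv y < J)%N, blk y == i & pos y == j].
pose T' (j : 'I_l) x := \sum_(y <- s | B i j y) T y x.
have lawT' r j : output_law r T' j = \sum_(y <- s | B i j y) output_law r T y.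
  by rewrite exchange_big; apply: eq_bigr => x _; rewrite mulr_sumr.
exists T'; split=> [j x|x|x x' j|].
- exact: sumr_ge0.
- apply: le_trans (sumT x).
  rewrite /T' [leRHS](bigID (fun y => (lv y < J)%N && (blk y == i))) /=.
  rewrite [X in _ <= X + _](partition_big pos xpredT) //=.
  rewrite -[leLHS]addr0; apply: lerD; last exact: sumr_ge0.
  by apply: ler_sum => j _; under [leRHS]eq_bigl do rewrite -andbA.
- by rewrite mulr_sumr; apply: ler_sum => y _; exact: ldpT.
have merge : \sum_(y <- s | (lv y < J)%N && (blk y == i)) lecam (P y) (Q y) <=
    4 * \sum_j lecam (output_law p T' j) (output_law q T' j).
  rewrite (partition_big pos xpredT) //= mulr_sumr; apply: ler_sum => j _.
  under eq_bigl do rewrite -andbA.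
  (* [b] is the group index recovered from block and position; its half is the level and its parity
     the sign. *)
  rewrite !lawT'; pose b := (i * l + j)%N.
  have Bb y : B i j y -> lv y = b./2 /\ sg y = odd b :> nat.
    move=> /and3P[lvJ /eqP bi /eqP pj].
    have -> : b = bk y.
      by rewrite /b -bi -pj (blkE _ lvJ) /= -divn_eq.
    rewrite /bk /sg; case: (_ <= _); rewrite ?addn1 ?addn0 /=.
      by rewrite uphalf_double odd_double.
    by rewrite doubleK odd_double.
  apply: (@lecam_merge _ _ _ _ _ _ (2^-1 ^+ b./2) ((-1) ^+ ~~ odd b)) => //.
  - by rewrite sqrr_sign.
  - move=> y By; have [<- sgE] := Bb y By; have [_ _ h] := hlv y.
    apply: le_trans (h _) _; first by case/and3P: By.
    move: sgE; rewrite /sg; case: leP => QP; case: odd => // _.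
      by rewrite expr0 mul1r ger0_norm ?subr_ge0.
    by rewrite expr1 mulN1r ler0_norm ?subr_le0 ?(ltW QP).
  - move=> y By; have [<- _] := Bb y By; have [_ h _] := hlv y.
    apply: le_trans h; case: (~~ odd b).
      by rewrite expr1 mulN1r -normrN ler_norm.
    by rewrite expr0 mul1r ler_norm.
have lnn0 : 0 <= ln (n%:R : R) by rewrite ln_ge0 // ler1n.
(* From [N - 1 <= 2 J / l] and [trunc_log 2 n <= 2 ln n]. This 4, the 2 lost to level [J] and the 4
   lost in merging make 32. *)
have NB : N%:R <= 4 * (1 + ln n%:R / l%:R) :> R.
  have l2 : 2 <= l%:R :> R by rewrite ler_nat.
  have l0R : 0 < l%:R :> R by rewrite ltr0n.
  have : (N.-1 * l)%:R <= (J.*2)%:R :> R by rewrite ler_nat leq_divM.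
  rewrite natrM -mul2n natrM /J -addn2 natrD => h.
  have tl := trunc_log_ln R n0.
  have Nm : N%:R = N.-1%:R + 1 :> R by rewrite natr1.
  have : N.-1%:R <= (4 + 4 * ln n%:R) / l%:R :> R.
    by rewrite ler_pdivlMr //; apply: le_trans h _; lra.
  have : 4 / l%:R <= 2 :> R by rewrite ler_pdivrMr //; lra.
  have -> : (4 + 4 * ln n%:R) / l%:R = 4 / l%:R + 4 * (ln n%:R / l%:R) :> R.
    by ring.
  by rewrite Nm; move: (ln _ / _) (4 / _) => u v; lra.
set LC' := \sum_y _ in merge *.
have LC'0 : 0 <= LC'.
  apply: sumr_ge0 => j _; apply: lecam_ge0; rewrite lawT'; exact: sumr_ge0.
apply: le_trans big _; rewrite -/LC.
have h1 : N%:R * \sum_(y <- s | (lv y < J)%N && (blk y == i)) lecam (P y) (Q y)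
    <= N%:R * (4 * LC') by apply: ler_wpM2l.
have h2 : N%:R * LC' <= 4 * (1 + ln n%:R / l%:R) * LC' by apply: ler_wpM2r.
have := le_trans (le_trans half hi) h1; lra.
Qed.

(** * Total correctness with running time *)

Section Hoare.
Variable R : realType.
Implicit Types (s : state R) (c : prog) (Q : state R -> Prop).

(** A total-correctness triple with a time bound, read as a precondition on [s]; sequencing nests
    [runs] in the postcondition. *)
Definition runs c (T : nat) Q s : Prop :=
  exists t s', [/\ exec c s t s', (t <= T)%N & Q s'].

Definition iset s (a i v : nat) : state R :=
  State (update (imem s) a i v) (rmem s).

Definition rset s (a i : nat) (v : R) : state R :=
  State (imem s) (update (rmem s) a i v).

Lemma runs_le c T T' Q Q' s :
  runs c T Q s -> (T <= T')%N -> (forall s', Q s' -> Q' s') -> runs c T' Q' s.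
Proof.
move=> [t [s' [ex tT Qs']]] TT' QQ'; exists t, s'; split=> //; last exact: QQ'.
exact: leq_trans TT'.
Qed.

Lemma runs_skip Q s : Q s -> runs Skip 1 Q s.
Proof. by move=> Qs; exists 1%N, s; split=> //; exact: ExecSkip. Qed.

Lemma runs_iset a i e Q s :
  Q (iset s a (ieval s i) (ieval s e)) -> runs (ISet a i e) 1 Q s.
Proof. by move=> Qs; eexists _, _; split; [exact: ExecISet| |exact: Qs]. Qed.

Lemma runs_rset a i e Q s :
  Q (rset s a (ieval s i) (reval s e)) -> runs (RSet a i e) 1 Q s.
Proof. by move=> Qs; eexists _, _; split; [exact: ExecRSet| |exact: Qs]. Qed.

Lemma runs_seq c1 c2 T1 T2 Q s :
  runs c1 T1 (runs c2 T2 Q) s -> runs (Seq c1 c2) (T1 + T2) Q s.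
Proof.
move=> [t1 [s1 [ex1 t1T [t2 [s2 [ex2 t2T Qs]]]]]].
exists (t1 + t2)%N, s2; split=> //; [exact: ExecSeq ex1 ex2|exact: leq_add].
Qed.

Lemma runs_if b c1 c2 T Q s :
  (beval s b -> runs c1 T Q s) -> (~~ beval s b -> runs c2 T Q s) ->
  runs (If b c1 c2) T.+1 Q s.
Proof.
case bs: (beval s b) => h1 h2.
  have [t [s' [ex tT Qs']]] := h1 isT.
  by exists t.+1, s'; split=> //; apply: ExecIfTrue.
have [t [s' [ex tT Qs']]] := h2 isT.
by exists t.+1, s'; split=> //; apply: ExecIfFalse => //; rewrite bs.
Qed.

(** [Inv] is indexed by fuel, the number of iterations that may remain; the bound charges one test
    per iteration and the final failing one. *)
Lemma runs_while b c T Q (Inv : nat -> state R -> Prop) m s :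
  (forall s, Inv 0 s -> ~~ beval s b) ->
  (forall i s, Inv i s -> ~~ beval s b -> Q s) ->
  (forall i s, Inv i.+1 s -> beval s b -> runs c T (Inv i) s) ->
  Inv m s -> runs (While b c) (m * T.+1 + 1) Q s.
Proof.
move=> h0 hQ hS; elim: m s => [|m IH] s Is; case bs: (beval s b).
- by have := h0 s Is; rewrite bs.
- exists 1%N, s; split=> //; first by apply: ExecWhileFalse; rewrite bs.
  by apply: hQ Is _; rewrite bs.
- have [t1 [s1 [ex1 t1T Is1]]] := hS m s Is bs.
  have [t2 [s2 [ex2 t2T Qs2]]] := IH s1 Is1.
  exists (t1 + t2).+1, s2; split=> //; first exact: ExecWhileTrue ex1 ex2.
  by rewrite mulSn; lia.
- exists 1%N, s; split=> //; first by apply: ExecWhileFalse; rewrite bs.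
  by apply: hQ Is _; rewrite bs.
Qed.

(** [A] and [B] list the integer and the real arrays that may have changed. *)
Definition frame (A B : seq nat) s s' : Prop :=
  (forall a, a \notin A -> imem s' a = imem s a) /\
  (forall a, a \notin B -> rmem s' a = rmem s a).

Lemma frame_refl A B s : frame A B s s.
Proof. by []. Qed.

Lemma frame_trans A B s1 s2 s3 :
  frame A B s1 s2 -> frame A B s2 s3 -> frame A B s1 s3.
Proof.
by move=> [i12 r12] [i23 r23]; split=> a aA; rewrite ?i23 ?r23 ?i12 ?r12.
Qed.

Lemma frame_sub A B A' B' s s' :
  all (mem A') A && all (mem B') B -> frame A B s s' -> frame A' B' s s'.
Proof.
move=> /andP[/allP AA /allP BB] [hi hr].
by split=> a aA; [apply: hi|apply: hr]; apply: contra aA; [exact: AA|exact: BB].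
Qed.

Lemma frame_iset A B s s1 a i v :
  frame A B s s1 -> a \in A -> frame A B s (iset s1 a i v).
Proof.
move=> [hi hr] aA; split=> // b bA; rewrite -hi //; apply: funext => j.
by rewrite /= /update; case: eqP => //= ba; rewrite ba aA in bA.
Qed.

Lemma frame_rset A B s s1 a i v :
  frame A B s s1 -> a \in B -> frame A B s (rset s1 a i v).
Proof.
move=> [hi hr] aB; split=> // b bB; rewrite -hr //; apply: funext => j.
by rewrite /= /update; case: eqP => //= ba; rewrite ba aB in bB.
Qed.

End Hoare.

Definition ivar (a : nat) : iexp := IGet a (ICst 0).
Definition rvar (a : nat) : rexp := RGet a (ICst 0).
Definition incr (a : nat) : prog :=
  ISet a (ICst 0) (IAdd (ivar a) (ICst 1)).
Definition blt (e1 e2 : iexp) : bexp := BILe (IAdd e1 (ICst 1)) e2.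
Definition for_loop (v : nat) (b : iexp) (body : prog) : prog :=
  Seq (ISet v (ICst 0) (ICst 0)) (While (blt (ivar v) b) (Seq body (incr v))).

Definition for_time (n T : nat) : nat := 1 + (n * (T + 1).+1 + 1).

Lemma runs_for (R : realType) (v : nat) (b : iexp) (body : prog) (n T : nat)
    (Inv : nat -> state R -> Prop) (s : state R) :
  Inv 0 (iset s v 0 0) ->
  (forall i s, Inv i s -> imem s v 0 = i /\ ieval s b = n) ->
  (forall i s, (i < n)%N -> Inv i s ->
     runs body T
       (fun s' => imem s' v 0 = i /\ Inv i.+1 (iset s' v 0 i.+1)) s) ->
  runs (for_loop v b body) (for_time n T) (Inv n) s.
Proof.
move=> I0 Iv IS; apply: runs_seq; apply: runs_iset => /=.
apply: (@runs_while _ _ _ _ _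
  (fun f s => exists2 i, (i + f = n)%N & Inv i s)); last by exists 0%N.
- move=> s1 [i iN Is] /=; have [-> ->] := Iv i s1 Is.
  by rewrite -ltnNge; lia.
- move=> f s1 [i fn Is] /=; have [-> ->] := Iv i s1 Is => h.
  by have -> : n = i by lia.
move=> f s1 [i fn Is] _; apply: runs_seq.
apply: runs_le (IS i s1 _ Is) (leqnn _) _; first by lia.
move=> s2 [s2v Is2]; apply: runs_iset; exists i.+1; first by lia.
by rewrite /= s2v addn1.
Qed.

(** * Exhaustive search over threshold maps *)

(* Integer arrays: 2 digits (an odometer in base [k + 1]), 3 number of outputs,
   4 current output, 5 current input, 6 its label, 7 digit position, 8 pointer
   into the written channel.  Real arrays: 3 the channel, 4 number of outputs,
   5 and 6 cell sums, 7 current value, 8 best value. *)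
Definition key_exp (i : iexp) : rexp :=
  RDiv (RGet 1 i) (RAdd (RGet 1 i) (RGet 2 i)).

Definition label_prog : prog :=
  Seq (ISet 6 (ICst 0) (ICst 0))
      (for_loop 7 (ISub (ivar 3) (ICst 1))
        (If (BAnd (blt (IGet 2 (ivar 7)) (ivar 0))
                  (BRLe (key_exp (IGet 2 (ivar 7))) (key_exp (ivar 5))))
            (incr 6) Skip)).

Definition same_cell : bexp :=
  BAnd (BILe (ivar 6) (ivar 4)) (BILe (ivar 4) (ivar 6)).

Definition minus1 (r : rexp) : rexp := RSub r (RCst 1).

Definition value_prog : prog :=
  Seq (RSet 7 (ICst 0) (RCst 0))
      (for_loop 4 (ivar 3)
        (Seq (RSet 5 (ICst 0) (RCst 0))
        (Seq (RSet 6 (ICst 0) (RCst 0))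
        (Seq (for_loop 5 (ivar 0)
               (Seq label_prog
                  (If same_cell
                    (Seq (RSet 5 (ICst 0) (RAdd (rvar 5)
                           (RSub (RGet 1 (ivar 5)) (RGet 2 (ivar 5)))))
                         (RSet 6 (ICst 0) (RAdd (rvar 6)
                           (RAdd (RGet 1 (ivar 5)) (RGet 2 (ivar 5))))))
                    Skip)))
             (RSet 7 (ICst 0) (RAdd (rvar 7)
               (RDiv (RMul (rvar 5) (rvar 5))
                 (RAdd (RCst 2) (RMul (minus1 (rvar 0)) (rvar 6)))))))))).

Definition write_prog : prog :=
  Seq (ISet 8 (ICst 0) (ICst 0))
      (for_loop 4 (ivar 1)
        (for_loop 5 (ivar 0)
          (Seq label_prog
          (Seq (If (blt (ivar 4) (ivar 3))
                 (If same_cell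
                   (RSet 3 (ivar 8)
                     (RDiv (rvar 0) (RAdd (rvar 4) (minus1 (rvar 0)))))
                   (RSet 3 (ivar 8)
                     (RDiv (RCst 1) (RAdd (rvar 4) (minus1 (rvar 0))))))
                 (RSet 3 (ivar 8) (RCst 0)))
               (incr 8))))).

(** An odometer step: digits equal to [k] are reset and the carry moves on. Position [L - 1] is an
    overflow digit whose first change ends the search. *)
Definition next_prog : prog :=
  Seq (ISet 7 (ICst 0) (ICst 0))
  (Seq (While (BILe (ivar 0) (IGet 2 (ivar 7)))
          (Seq (ISet 2 (ivar 7) (ICst 0)) (incr 7)))
       (ISet 2 (ivar 7) (IAdd (IGet 2 (ivar 7)) (ICst 1)))).

Definition level_prog : prog :=
  Seq (ISet 3 (ICst 0) (ICst 2))
  (Seq (RSet 4 (ICst 0) (RCst 2))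
       (While (BAnd (blt (ivar 3) (ivar 1)) (BNot (BRLe (rvar 0) (rvar 4))))
          (Seq (incr 3) (RSet 4 (ICst 0) (RAdd (rvar 4) (RCst 1)))))).

(** The non-strict comparison with the initial best value 0 ensures that the first map is
    recorded. *)
Definition search_prog : prog :=
  Seq level_prog
      (While (BILe (IGet 2 (ISub (ivar 3) (ICst 1))) (ICst 0))
        (Seq value_prog
        (Seq (If (BRLe (rvar 8) (rvar 7))
               (Seq (RSet 8 (ICst 0) (rvar 7)) write_prog) Skip)
             next_prog))).

Definition label_time (M : nat) : nat := 1 + for_time M 2.
Definition value_time (k L : nat) : nat :=
  1 + for_time L (1 + (1 + (for_time k (label_time L.-1 + 3) + 1))).
Definition write_time (k l L : nat) : nat :=
  1 + for_time l (for_time k (label_time L.-1 + (3 + 1))).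
Definition next_time (L : nat) : nat := 1 + ((L.-1 * 3 + 1) + 1).

(** * Correctness of the subroutines *)

Section Verification.
Variables (R : realType) (k l L : nat) (p q : 'I_k -> R) (E : R).
Implicit Types (s : state R).

Definition env s : Prop :=
  [/\ imem s 0 0 = k, imem s 1 0 = l, imem s 3 0 = L
    & [/\ rmem s 0 0 = 1 + E, rmem s 1 = pad p, rmem s 2 = pad q
        & rmem s 4 0 = L%:R]].

Lemma env_frame A B s s' :
  frame A B s s' ->
  [&& 0 \notin A, 1 \notin A, 3 \notin A, 0 \notin B, 1 \notin B, 2 \notin B
    & 4 \notin B]%N ->
  env s -> env s'.
Proof.
move=> [hi hr] /and5P[a0 a1 a3 b0 /and3P[b1 b2 b4]] [e1 e2 e3 [f1 f2 f3 f4]].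
by split; rewrite ?hi //; split; rewrite ?hr.
Qed.

Lemma runs_label s : env s ->
  runs label_prog (label_time L.-1)
    (fun s' => frame [:: 6; 7] [::] s s' /\
       imem s' 6 0 = label p q L.-1 (imem s 2) (imem s 5 0)) s.
Proof.
move=> Es; apply: runs_seq; apply: runs_iset => /=.
pose Inv i s' := [/\ frame [:: 6; 7] [::] s s', imem s' 7 0 = i
  & imem s' 6 0 = label p q i (imem s 2) (imem s 5 0)].
apply: runs_le (@runs_for R 7 _ _ L.-1 2 Inv _ _ _ _) (leqnn _) _.
- split.
  + by do 2!apply: frame_iset => //; exact: frame_refl.
  + by [].
  + by rewrite /label big_ord0.
- move=> i s1 [fr s17 _]; split=> //=.
  by have [_ _ -> _] := env_frame fr isT Es; rewrite subn1.
- move=> i s1 iM [fr s17 s16].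
  have [e1 _ _ [_ e2 e3 _]] := env_frame fr isT Es.
  have s12 : imem s1 2 = imem s 2 by apply: fr.1.
  have s15 : imem s1 5 = imem s 5 by apply: fr.1.
  have labS : label p q i.+1 (imem s 2) (imem s 5 0) =
      (label p q i (imem s 2) (imem s 5 0) +
       ((imem s 2 i < k)%N && (nat_key p q (imem s 2 i) <=
                               nat_key p q (imem s 5 0))%R))%N.
    by rewrite /label big_ord_recr.
  apply: runs_if => /=; rewrite e1 e2 e3 s17 s12 s15 addn1 => test.
    apply: runs_iset; split=> //=; split=> //=.
    + by do 2!apply: frame_iset => //.
    + by rewrite /update /= labS -s16 /nat_key test.
  apply: runs_skip; split=> //=; split=> //=.
  + exact: frame_iset.
  + by rewrite /update /= labS -s16 /nat_key (negPf test) addn0.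
- by move=> s1 [fr _ s16].
Qed.

Lemma runs_value s : env s ->
  runs value_prog (value_time k L)
    (fun s' => frame [:: 4; 5; 6; 7] [:: 5; 6; 7] s s' /\
       rmem s' 7 0 =
         value p q E L (fun x : 'I_k => label p q L.-1 (imem s 2) x)) s.
Proof.
move=> Es; pose lab x := label p q L.-1 (imem s 2) x.
pose U m j := \sum_(0 <= x < m | lab x == j) (pad p x - pad q x).
pose W m j := \sum_(0 <= x < m | lab x == j) (pad p x + pad q x).
pose V j := \sum_(i < j) U k i ^+ 2 / (2 + E * W k i).
pose fr s' := frame [:: 4; 5; 6; 7] [:: 5; 6; 7] s s'.
pose Inv j s' := [/\ fr s', imem s' 4 0 = j & rmem s' 7 0 = V j].
apply: runs_seq; apply: runs_rset.
apply: runs_le (@runs_for R 4 _ _ L _ Inv _ _ _ _) (leqnn _) _.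
- split=> //.
    by apply: frame_iset => //; apply: frame_rset => //; exact: frame_refl.
  by rewrite /V big_ord0.
- move=> j s1 [f1 s14 _]; split=> //=.
  by have [_ _ -> _] := env_frame f1 isT Es.
- move=> j s1 jL [f1 s14 s17].
  apply: runs_seq; apply: runs_rset; apply: runs_seq; apply: runs_rset.
  apply: runs_seq.
  pose Inv2 x s' := [/\ fr s', imem s' 4 0 = j, imem s' 5 0 = x
    & [/\ rmem s' 5 0 = U x j, rmem s' 6 0 = W x j & rmem s' 7 0 = V j]].
  apply: runs_le (@runs_for R 5 _ _ k (label_time L.-1 + 3) Inv2 _ _ _ _)
    (leqnn _) _.
  + split=> //.
      by apply: frame_iset => //; do 2!apply: frame_rset => //.
    by rewrite /U /W !big_nil /= /update /= mulr0n.
  + move=> x s2 [f2 s24 s25 _]; split=> //=.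
    by have [-> _ _ _] := env_frame f2 isT Es.
  + move=> x s2 xk [f2 s24 s25 [s2U s2W s2V]].
    have E2 := env_frame f2 isT Es.
    apply: runs_seq; apply: runs_le (runs_label E2) (leqnn _) _.
    move=> s3 [f23 s36].
    have f3 : fr s3 by apply: frame_trans f2 _; apply: frame_sub f23.
    have [_ _ _ [_ s3p s3q _]] := env_frame f3 isT Es.
    have s22 : imem s2 2 = imem s 2 by apply: f2.1.
    have s34 : imem s3 4 0 = j by rewrite f23.1.
    have s35 : imem s3 5 0 = x by rewrite f23.1.
    have r3 : rmem s3 = rmem s2 by apply: funext => a; exact: f23.2.
    rewrite s22 s25 -/(lab x) in s36.
    have US : U x.+1 j = U x j + (if lab x == j then pad p x - pad q x else 0).
      by rewrite /U big_mkcond big_nat_recr //= -big_mkcond.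
    have WS : W x.+1 j = W x j + (if lab x == j then pad p x + pad q x else 0).
      by rewrite /W big_mkcond big_nat_recr //= -big_mkcond.
    apply: runs_if => /=; rewrite s34 s36 -eqn_leq => test.
      apply: (@runs_seq _ _ _ 1 1).
      apply: runs_rset; apply: runs_rset; split=> //=; split=> //=.
        by apply: frame_iset => //; do 2!apply: frame_rset => //.
      rewrite /update /= US WS test s3p s3q s35 r3 s2U s2W s2V.
      by split.
    apply: runs_le (runs_skip _) _ (fun _ h => h) => //.
    split=> //=; split=> //=; first exact: frame_iset.
    by rewrite US WS (negPf test) !addr0 r3.
  move=> s2 [f2 s24 s25 [s2U s2W s2V]].
  have [_ _ _ [e0 _ _ _]] := env_frame f2 isT Es.
  apply: runs_rset; split=> //=; split=> //=.
    by apply: frame_iset => //; apply: frame_rset.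
  rewrite /update /= /V big_ord_recr /= -/(V j) e0 s2U s2W s2V expr2.
  by rewrite [1 + E]addrC addrK.
- move=> s1 [f1 _ s17]; split=> //; rewrite s17; apply: eq_bigr => i _.
  rewrite /U /W !big_mkord /cell_sum.
  congr (_ ^+ 2 / (2 + E * _)); apply: eq_big => // x _;
    by rewrite !pad_ord.
Qed.

Lemma runs_write s : env s ->
  runs write_prog (write_time k l L)
    (fun s' => frame [:: 4; 5; 6; 7; 8] [:: 3] s s' /\
       forall y x, (y < l)%N -> (x < k)%N -> rmem s' 3 (y * k + x)%N =
         rand_resp E L y (label p q L.-1 (imem s 2) x)) s.
Proof.
move=> Es; pose lab x := label p q L.-1 (imem s 2) x.
(* The row-major position [i] stands for output [i %/ k] and input [i %% k]. *)
pose W i := rand_resp E L (i %/ k) (lab (i %% k)%N).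
pose fr s' := frame [:: 4; 5; 6; 7; 8] [:: 3] s s'.
pose out n s' := forall i, (i < n)%N -> rmem s' 3 i = W i.
pose Inv j s' := [/\ fr s', imem s' 4 0 = j, imem s' 8 0 = (j * k)%N
  & out (j * k)%N s'].
apply: runs_seq; apply: runs_iset.
apply: runs_le (@runs_for R 4 _ _ l _ Inv _ _ _ _) (leqnn _) _.
- split=> //.
  by do 2!apply: frame_iset => //; exact: frame_refl.
- move=> j s1 [f1 s14 _ _]; split=> //=.
  by have [_ -> _ _] := env_frame f1 isT Es.
- move=> j s1 jl [f1 s14 s18 o1].
  pose Inv2 x s' := [/\ fr s', imem s' 4 0 = j, imem s' 5 0 = x,
    imem s' 8 0 = (j * k + x)%N & out (j * k + x)%N s'].
  apply: runs_le (@runs_for R 5 _ _ k (label_time L.-1 + (3 + 1)) Inv2 _ _ _ _)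
    (leqnn _) _.
  + by split; rewrite ?addn0 //; apply: frame_iset.
  + move=> x s2 [f2 s24 s25 _ _]; split=> //=.
    by have [-> _ _ _] := env_frame f2 isT Es.
  + move=> x s2 xk [f2 s24 s25 s28 o2].
    have E2 := env_frame f2 isT Es.
    apply: runs_seq; apply: runs_le (runs_label E2) (leqnn _) _.
    move=> s3 [f23 s36].
    have f3 : fr s3 by apply: frame_trans f2 _; apply: frame_sub f23.
    have [_ _ s33 [s3e _ _ s3L]] := env_frame f3 isT Es.
    have s22 : imem s2 2 = imem s 2 by apply: f2.1.
    have s34 : imem s3 4 0 = j by rewrite f23.1.
    have s35 : imem s3 5 0 = x by rewrite f23.1.
    have s38 : imem s3 8 0 = (j * k + x)%N by rewrite f23.1.
    have r3 : rmem s3 = rmem s2 by apply: funext => a; exact: f23.2.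
    rewrite s22 s25 -/(lab x) in s36.
    have k0 : (0 < k)%N by apply: leq_ltn_trans xk.
    have WE : W (j * k + x)%N = rand_resp E L j (lab x).
      by rewrite /W divnMDl // divn_small // addn0 modnMDl modn_small.
    have step v : v = rand_resp E L j (lab x) ->
        runs (incr 8) 1 (fun s' => imem s' 5 0 = x /\
          Inv2 x.+1 (iset s' 5 0 x.+1)) (rset s3 3 (j * k + x)%N v).
      move=> vE; apply: runs_iset; split=> //=; split=> //=.
      * by do 2!apply: frame_iset => //; apply: frame_rset.
      * by rewrite /update /= s38 -addnA addn1.
      move=> i; rewrite /= /update /= addnS ltnS leq_eqVlt.
      case: eqP => [-> _|_ /= iN]; first by rewrite WE.
      by rewrite r3; exact: o2.
    apply: runs_seq; apply: runs_if => /=; rewrite s34 s33 addn1 => jL.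
      apply: runs_if => /=; rewrite s34 s36 -eqn_leq => test.
        apply: runs_rset => /=; rewrite s38 s3e s3L; apply: step.
        by rewrite /rand_resp jL test [X in _ + (X - _)]addrC addrK.
      apply: runs_rset => /=; rewrite s38 s3e s3L; apply: step.
      by rewrite /rand_resp jL (negPf test) [X in _ + (X - _)]addrC addrK.
    apply: runs_le (runs_rset _) _ (fun _ h => h) => //=.
    rewrite s38; apply: step.
    by rewrite /rand_resp (negPf jL).
  move=> s2 [f2 s24 _ s28 o2]; split=> //; split=> //=.
  + exact: frame_iset.
  + by rewrite /update /= s28 mulSn addnC.
  + by rewrite mulSn addnC.
- move=> s1 [f1 _ _ o1]; split=> // y x yl xk.
  have k0 : (0 < k)%N by apply: leq_ltn_trans xk.
  rewrite o1; last by apply: leq_trans (_ : y.+1 * k <= _)%N;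
    [rewrite mulSn addnC ltn_add2r|rewrite leq_mul2r yl orbT].
  by rewrite /W divnMDl // divn_small // addn0 modnMDl modn_small.
Qed.

(** * Tuples of threshold digits as numbers in base [k + 1] *)

Definition code (d : nat -> nat) (M : nat) : nat :=
  (\sum_(i < M) d i * k.+1 ^ i)%N.

Lemma code_lt d M : (forall i, (i < M)%N -> (d i <= k)%N) ->
  (code d M < k.+1 ^ M)%N.
Proof.
elim: M => [|M IH] dk; first by rewrite /code big_ord0.
have := IH (fun i iM => dk i (ltnW iM)); have := dk M (ltnSn M).
rewrite /code big_ord_recr /= expnS; move: (\sum_(i < M) _)%N => S.
by move: (k.+1 ^ M)%N => B; nia.
Qed.

Lemma code_inj d e M :
  (forall i, (i < M)%N -> (d i <= k)%N) ->
  (forall i, (i < M)%N -> (e i <= k)%N) ->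
  code d M = code e M -> forall i, (i < M)%N -> d i = e i.
Proof.
elim: M => // M IH dk ek; rewrite /code !big_ord_recr /= -/(code d M).
rewrite -/(code e M).
have dk' i : (i < M)%N -> (d i <= k)%N by move=> iM; exact/dk/ltnW.
have ek' i : (i < M)%N -> (e i <= k)%N by move=> iM; exact/ek/ltnW.
have hd := code_lt dk'; have he := code_lt ek' => h.
have B0 : (0 < k.+1 ^ M)%N by rewrite expn_gt0.
have eqM : d M = e M.
  have := congr1 (fun n => n %/ k.+1 ^ M)%N h.
  by rewrite !divnDMl // !divn_small.
move=> i; rewrite ltnS leq_eqVlt => /predU1P[->//|iM].
by apply: IH => //; move: h; rewrite eqM; exact: addIn.
Qed.

Lemma code_update d M j v :
  (j < M)%N ->
  (code (fun i => if i == j then v else d i) M + d j * k.+1 ^ j =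
   code d M + v * k.+1 ^ j)%N.
Proof.
move=> jM; rewrite /code (bigD1 (Ordinal jM)) //= eqxx.
rewrite [in RHS](bigD1 (Ordinal jM)) //=.
rewrite (eq_bigr (fun i : 'I_M => d i * k.+1 ^ i)%N); first by lia.
by move=> i; rewrite -val_eqE /= => /negPf ->.
Qed.

Lemma runs_next s : env s -> (0 < k)%N ->
  (forall i, (i <= L.-1)%N -> (imem s 2 i <= k)%N) -> imem s 2 L.-1 = 0 ->
  runs next_prog (next_time L)
    (fun s' => [/\ frame [:: 2; 7] [::] s s',
       forall i, (i <= L.-1)%N -> (imem s' 2 i <= k)%N
     & code (imem s' 2) L.-1.+1 = (code (imem s 2) L.-1.+1).+1]) s.
Proof.
move=> Es k0 dk dL; apply: runs_seq; apply: runs_iset; apply: runs_seq.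
(* After [i] resets, a carry of [(k + 1)^i] is still to be added. The overflow digit is 0, below
   [k], so the carry stops there at the latest. *)
pose Inv f s' := exists2 i, (i + f = L.-1)%N &
  [/\ frame [:: 2; 7] [::] s s', imem s' 7 0 = i,
      forall i, (i <= L.-1)%N -> (imem s' 2 i <= k)%N, imem s' 2 L.-1 = 0
    & (code (imem s' 2) L.-1.+1 + k.+1 ^ i =
       (code (imem s 2) L.-1.+1).+1)%N].
apply: (@runs_while _ _ _ 2 _ Inv).
- move=> s1 [i iL [fr s17 s1k s1L _]] /=.
  have [-> _ _ _] := env_frame fr isT Es.
  by rewrite s17 -(addn0 i) iL s1L -ltnNge.
- move=> f s1 [i iL [fr s17 s1k s1L s1c]] /=.
  have [-> _ _ _] := env_frame fr isT Es; rewrite s17 -ltnNge => dik.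
  apply: runs_iset; rewrite /= s17; split.
  + exact: frame_iset.
  + move=> j jL; rewrite /= /update /=; case: ifP => [_|_]; last exact: s1k.
    by rewrite addn1.
  have iL1 : (i < L.-1.+1)%N by lia.
  have := code_update (imem s1 2) (imem s1 2 i + 1) iL1.
  by rewrite -s1c /= /update /=; lia.
- move=> f s1 [i iL [fr s17 s1k s1L s1c]] /=.
  have [-> _ _ _] := env_frame fr isT Es; rewrite s17 => kdi.
  apply: (@runs_seq _ _ _ 1 1); apply: runs_iset; apply: runs_iset => /=.
  exists i.+1; first by lia.
  have iL1 : (i < L.-1.+1)%N by lia.
  have di : imem s1 2 i = k by apply/eqP; rewrite eqn_leq kdi s1k // -ltnS.
  rewrite s17; split.
  + by do 2!apply: frame_iset => //.
  + by rewrite /= /update /= s17 addn1.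
  + move=> j jL; rewrite /= /update /=; case: ifP => // _; exact: s1k.
  + by rewrite /= /update /=; case: ifP.
  have := code_update (imem s1 2) 0 iL1.
  by rewrite -s1c /= /update /= expnS di; lia.
- exists 0%N; first by rewrite add0n.
  split=> //=; last by rewrite /update /= expn0 addn1.
  by apply: frame_iset => //; exact: frame_refl.
Qed.

End Verification.

(** * Number of levels and the enumeration loop *)

Definition level_time (l : nat) : nat := 1 + (1 + (l * 3 + 1)).
Definition loop_time (k l L : nat) : nat :=
  k.+1 ^ L.-1
    * (value_time k L + ((1 + write_time k l L).+1 + next_time L)).+1 + 1.

Lemma runs_level (R : realType) (l : nat) (E : R) (s : state R) :
  (1 < l)%N -> 0 < E -> imem s 1 0 = l -> rmem s 0 0 = 1 + E ->
  runs level_prog (level_time l)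
    (fun s' => frame [:: 3] [:: 4] s s' /\ exists L,
       [/\ level_spec E l L, imem s' 3 0 = L & rmem s' 4 0 = L%:R]) s.
Proof.
move=> l1 E0 sl se; apply: runs_seq; apply: runs_iset; apply: runs_seq.
apply: runs_rset.
(* [L] grows only while [L < 1 + E], so that each increment leaves [L < 2 + E]. *)
pose Inv f s' := exists2 L, (L + f = l)%N &
  [/\ frame [:: 3] [:: 4] s s', (1 < L)%N, L = 2 \/ L%:R < 2 + E,
      imem s' 3 0 = L & rmem s' 4 0 = L%:R].
apply: runs_le (@runs_while R _ _ 2 _ Inv (l - 2) _ _ _ _ _) _ (fun _ h => h).
- move=> s1 [L Ll [fr _ _ sL _]] /=.
  by rewrite sL fr.1 // sl negb_and -ltnNge; apply/orP; left; lia.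
- move=> f s1 [L Ll [fr L1 Llo sL sLR]] /=.
  rewrite sL sLR fr.1 // fr.2 // sl se negb_and negbK => test.
  split=> //; exists L; split=> //; split=> //; first by lia.
  by case/orP: test => h; [left; lia|right].
- move=> f s1 [L Ll [fr L1 Llo sL sLR]] /=.
  rewrite sL sLR fr.1 // fr.2 // sl se -ltNge => /andP[h1 h2].
  apply: (@runs_seq _ _ _ 1 1); apply: runs_iset; apply: runs_rset.
  exists L.+1; first by lia.
  split; rewrite /= /update /= ?sL ?sLR ?addn1 ?natr1 //.
  + by apply: frame_rset => //; apply: frame_iset.
  + by lia.
  by right; rewrite -natr1; lra.
- exists 2; first by lia.
  split=> //; last by left.
  by apply: frame_rset => //; apply: frame_iset => //; exact: frame_refl.
- by rewrite -addn1; lia.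
Qed.

Lemma label_ext (R : realType) (k : nat) (p q : 'I_k -> R) (M : nat)
    (d e : nat -> nat) (x : nat) :
  (forall i, (i < M)%N -> d i = e i) -> label p q M d x = label p q M e x.
Proof. by move=> de; apply: eq_bigr => i _; rewrite de. Qed.

Lemma runs_loop (R : realType) (k l L : nat) (p q : 'I_k -> R) (E : R)
    (s : state R) :
  is_dist p -> is_dist q -> 0 < E -> (0 < k)%N -> (1 < L)%N ->
  env l L p q E s -> imem s 2 = (fun=> 0%N) -> rmem s 8 0 = 0 ->
  let val (d : nat -> nat) :=
    value p q E L (fun x : 'I_k => label p q L.-1 d x) in
  let digits (d : nat -> nat) := forall i, (i < L.-1)%N -> (d i <= k)%N in
  runs (While (BILe (IGet 2 (ISub (ivar 3) (ICst 1))) (ICst 0))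
        (Seq value_prog
        (Seq (If (BRLe (rvar 8) (rvar 7))
               (Seq (RSet 8 (ICst 0) (rvar 7)) write_prog) Skip)
             next_prog))) (loop_time k l L)
    (fun s' => exists d, [/\ digits d, forall e, digits e -> val e <= val d
       & forall y x, (y < l)%N -> (x < k)%N -> rmem s' 3 (y * k + x)%N =
           rand_resp E L y (label p q L.-1 d x)]) s.
Proof.
move=> dp dq E0 k0 L1 Es s2 s8 val digits.
set N := (k.+1 ^ L.-1)%N.
have val_ext d e : (forall i, (i < L.-1)%N -> d i = e i) -> val d = val e.
  move=> de; congr (value _ _ _ _ _); apply: funext => x; exact: label_ext.
have codeS d : code k d L.-1.+1 = (code k d L.-1 + d L.-1 * N)%N.
  by rewrite /code big_ord_recr.
pose out d s' := forall y x, (y < l)%N -> (x < k)%N ->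
  rmem s' 3 (y * k + x)%N = rand_resp E L y (label p q L.-1 d x).
(* [n] is both the code of the current tuple and the number of codes examined: all smaller codes
   have value at most the stored best, and past [n = 0] the stored best and the written channel come
   from one tuple. *)
pose Inv f s' := exists2 n, (n + f = N)%N &
  [/\ frame [:: 2; 4; 5; 6; 7; 8] [:: 3; 5; 6; 7; 8] s s',
      forall i, (i <= L.-1)%N -> (imem s' 2 i <= k)%N,
      code k (imem s' 2) L.-1.+1 = n,
      forall e, digits e -> (code k e L.-1 < n)%N -> val e <= rmem s' 8 0
    & (n = 0%N /\ rmem s' 8 0 = 0) \/
      exists d, [/\ digits d, rmem s' 8 0 = val d & out d s']].
have top n (s' : state R) : (code k (imem s' 2) L.-1.+1 = n)%N ->
    (forall i, (i <= L.-1)%N -> (imem s' 2 i <= k)%N) ->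
    (n <= N)%N -> (imem s' 2 L.-1 <= 0)%N = (n < N)%N.
  move=> cn dk nN; have := @code_lt k (imem s' 2) L.-1
    (fun i iM => dk i (ltnW iM)).
  rewrite -/N -cn codeS; move: (code _ _ _) (imem s' 2 _) => c [|m] cN /=.
    by rewrite mul0n addn0 cN.
  by rewrite mulSn; apply/esym/negbTE; rewrite -leqNgt; lia.
apply: (@runs_while _ _ _ _ _ Inv).
- move=> s1 [n nN [fr dk cn _ _]] /=.
  have [_ _ -> _] := env_frame fr isT Es.
  by rewrite subn1 (top n) // -?nN ?addn0 ?ltnn.
- move=> f s1 [n nN [fr dk cn hbest found]] /=.
  have [_ _ -> _] := env_frame fr isT Es.
  rewrite subn1 (top n) //; last by rewrite -nN leq_addr.
  rewrite -leqNgt => Nn; case: found => [[n0 _]|[d [dd bd od]]].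
    have N0 : (0 < N)%N by rewrite expn_gt0.
    by lia.
  exists d; split=> // e ee; rewrite -bd; apply: hbest => //.
  by apply: leq_trans Nn; exact: code_lt.
2: exists 0%N => //; split=> //; rewrite ?s2 //.
2: by rewrite /code big1.
2: by left.
move=> f s1 [n nN [fr dk cn hbest found]] /=.
have E1 := env_frame fr isT Es.
have [_ _ -> _] := E1; rewrite subn1 (top n) //; last by lia.
move=> nltN; set d1 := imem s1 2.
have d1L : d1 L.-1 = 0%N.
  by apply/eqP; rewrite -leqn0 (top n) //; lia.
have c1 : code k d1 L.-1 = n by rewrite -cn codeS -/d1 d1L mul0n addn0.
have dd1 : digits d1 by move=> i iL; apply: dk; exact: ltnW.
(* A tuple with code [n] agrees with the current one on the first [L - 1] digits, the only ones that
   the labels read. *)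
have same e : digits e -> (code k e L.-1 < n.+1)%N -> val e <= rmem s1 8 0 \/
    val e = val d1.
  move=> ee; rewrite ltnS leq_eqVlt => /predU1P[ce|/hbest h].
    right; apply: val_ext => i iL.
    by apply: (@code_inj k e d1 L.-1) => //; rewrite ce c1.
  by left; exact: h.
apply: runs_seq; apply: runs_le (runs_value E1) (leqnn _) _.
move=> s3 [f13 s37]; rewrite -/d1 -/(val d1) in s37.
have s32 : imem s3 2 = d1 by apply: f13.1.
have s38 : rmem s3 8 0 = rmem s1 8 0 by rewrite f13.2.
have E3 := env_frame f13 isT E1.
apply: runs_seq.
have next s4 : frame [:: 4; 5; 6; 7; 8] [:: 3; 5; 6; 7; 8] s3 s4 ->
    (forall e, digits e -> (code k e L.-1 < n.+1)%N -> val e <= rmem s4 8 0) ->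
    (exists d, [/\ digits d, rmem s4 8 0 = val d & out d s4]) ->
    runs next_prog (next_time L) (Inv f) s4.
  move=> f34 hb4 found4; have E4 := env_frame f34 isT E3.
  have s42 : imem s4 2 = d1 by rewrite f34.1.
  apply: runs_le (runs_next E4 k0 _ _) (leqnn _) _; rewrite ?s42 //.
  move=> s5 [f45 d5 c5]; exists n.+1; first by lia.
  have s58 : rmem s5 8 = rmem s4 8 by apply: f45.2.
  split=> //.
  + apply: frame_trans fr _; apply: frame_trans; first exact: frame_sub f13.
    apply: frame_trans; first exact: frame_sub f34.
    exact: frame_sub f45.
  + by rewrite c5 cn.
  + by rewrite s58.
  + right; have [d [dd bd od]] := found4; exists d; rewrite s58; split=> //.
    by move=> y x yl xk; rewrite f45.2 // od.
apply: runs_if => /=; rewrite s37 s38 => test.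
  apply: runs_seq; apply: runs_rset => /=.
  set s4 := rset _ _ _ _.
  have f34 : frame [::] [:: 8] s3 s4.
    by apply: frame_rset => //; exact: frame_refl.
  have E4 := env_frame f34 isT E3.
  apply: runs_le (runs_write E4) (leqnn _) _ => s5 [f45 o5].
  have s58 : rmem s5 8 0 = val d1 by rewrite f45.2 //= /update /= s37.
  apply: next.
  + apply: frame_trans; [exact: frame_sub f34|exact: frame_sub f45].
  + move=> e ee ce; rewrite s58; case: (same e ee ce) => [h|->//].
    exact: le_trans h test.
  + by exists d1; split=> //; move: o5; rewrite /= s32.
apply: runs_le (runs_skip _) (ltn0Sn _) (fun _ h => h).
have lt1 : val d1 < rmem s1 8 0 by rewrite ltNge.
apply: next; first exact: frame_refl.
  by move=> e ee ce; rewrite s38; case: (same e ee ce) => [//|->]; exact: ltW.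
(* A rejection at [n = 0] would need a negative value, since the best value starts at 0. *)
case: found => [[_ b0]|[d [dd bd od]]].
  by move: lt1; rewrite b0 ltNge value_ge0.
exists d; rewrite s38; split=> // y x yl xk.
by rewrite f13.2 // od.
Qed.

(** * Monotonicity in the likelihood ratio *)

Lemma key_le_ratio (R : realType) (k : nat) (p q : 'I_k -> R) (u v : 'I_k) :
  is_dist p -> is_dist q ->
  (likelihood_ratio p q u < likelihood_ratio p q v)%E ->
  key p q u <= key p q v.
Proof.
move=> dp dq; rewrite /likelihood_ratio /key !inver.
have := dp.1 u; have := dq.1 u; have := dp.1 v; have := dq.1 v.
move: (p u) (q u) (p v) (q v) => a b c d d0 c0 b0 a0.
(* Where [q = 0], the ratio is [+oo] and the key 1 if [p > 0], and both are 0 if [p = 0]; elsewhere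
   the key increases with [p / q]. *)
have [dz|dnz] := eqVneq d 0; have [bz|bnz] := eqVneq b 0.
- subst b d; rewrite !addr0; have [->|anz] := eqVneq a 0.
    by rewrite mul0r divr_ge0.
  have a_gt0 : (0 < a%:E)%E by rewrite lte_fin lt_neqAle eq_sym anz.
  rewrite (gt0_muley a_gt0) => h.
  by have := leey (c%:E * +oo)%E; rewrite leNgt h.
- subst d; rewrite addr0; have [->|cnz] := eqVneq c 0.
    rewrite mul0e -EFinM lte_fin => h.
    by have := divr_ge0 a0 b0; rewrite leNgt h.
  by move=> _; rewrite divff // ler_pdivrMr ?mul1r ?lerDl //;
    rewrite ltr_wpDl // lt_neqAle eq_sym bnz.
- subst b; have [->|anz] := eqVneq a 0.
    by rewrite mul0r divr_ge0 ?addr_ge0.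
  have a_gt0 : (0 < a%:E)%E by rewrite lte_fin lt_neqAle eq_sym anz.
  rewrite (gt0_muley a_gt0) -EFinM => h.
  by have := leey (c / d)%:E; rewrite leNgt h.
rewrite -!EFinM lte_fin => h.
have b_gt0 : 0 < b by rewrite lt_neqAle eq_sym bnz.
have d_gt0 : 0 < d by rewrite lt_neqAle eq_sym dnz.
move: h; rewrite ltr_pdivrMr // mulrAC ltr_pdivlMr // => h.
rewrite ler_pdivrMr ?ltr_wpDl // mulrAC ler_pdivlMr ?ltr_wpDl //.
by nra.
Qed.

Lemma label_threshold (R : realType) (k M m : nat) (p q : 'I_k -> R)
    (d : nat -> nat) (f : 'I_k -> 'I_m) :
  is_dist p -> is_dist q -> (forall x, f x = label p q M d x :> nat) ->
  is_threshold p q f.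
Proof.
move=> dp dq fE u v uv fuv w uw wv.
have mono a b : (likelihood_ratio p q a < likelihood_ratio p q b)%E ->
    (f a <= f b)%N.
  move=> /(key_le_ratio dp dq) h; rewrite !fE; apply: leq_sum => i _.
  case: (d i < k)%N => //=; rewrite !nat_keyE.
  by have [/le_trans/(_ h)->//|] := leP (nat_key p q (d i)) (key p q a).
have h1 := mono u w uw; have h2 := mono w v wv.
have fwu : f w = f u by apply: val_inj; move: h2; rewrite -fuv => h2; apply/eqP;
  rewrite eqn_leq h1 h2.
by rewrite -fuv fwu.
Qed.

(** A non-empty set of integers attains its infimum, so a finite sample complexity comes with an
    actual test. *)
Lemma sample_complexity_cases (R : realType) (k : nat) (Y : countType)
    (C : set (Y -> 'I_k -> R)) (p q : 'I_k -> R) :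
  sample_complexity C p q = +oo%E \/
  exists2 n, testable C p q n & sample_complexity C p q = (n%:R)%:E.
Proof.
have [[n0 tn0]|none] := pselect (exists n, testable C p q n); last first.
  left; rewrite /sample_complexity; set S := (X in ereal_inf X).
  have -> : S = set0.
    by apply/seteqP; split=> // x [n tn _]; apply: none; exists n.
  exact: ereal_inf0.
right; have ex : exists n, `[< testable C p q n >] by exists n0; apply/asboolP.
have [n /asboolP tn nmin] := ex_minnP ex; exists n => //.
apply/le_anti/andP; split; first by apply: ereal_inf_lbound; exists n.
apply/ereal_infP => _ [m tm <-]; rewrite lee_fin ler_nat.
by apply: nmin; apply/asboolP.
Qed.

Lemma testable_ldp_lecam (R : realType) (k n : nat) (Y : countType)
    (p q : 'I_k -> R) (eps : R) :
  is_dist p -> is_dist q -> testable (@ldp_channels R 'I_k Y eps) p q n ->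
  (0 < n)%N /\ exists T : Y -> 'I_k -> R, [/\ is_channel T, is_ldp eps T
    & exists F : {fset Y}, (2 * n%:R)^-1 <=
        \sum_(y <- F) lecam (output_law p T y) (output_law q T y)].
Proof.
move=> dp dq [T [CT [phi err]]].
have [i [F h]] := testable_lecam dp dq (fun i => (CT i).1) err.
split; first exact: leq_ltn_trans (ltn_ord i).
by exists (T i); split; [exact: (CT i).1|exact: (CT i).2|exists F].
Qed.

(** * Running time *)

Lemma search_time_le (k l L : nat) : (0 < k)%N -> (0 < L)%N -> (L <= l)%N ->
  (level_time l + loop_time k l L <= 60 * (k * k ^ l) * (l ^ 2 * 2 ^ l))%N.
Proof.
move=> k0 L0 Ll.
have lab : (label_time L.-1 <= 4 * l)%N.
  by rewrite /label_time /for_time; lia.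
have val : (value_time k L <= 3 + l * (7 + k * (4 * l + 5)))%N.
  rewrite /value_time /for_time; set a := label_time _ in lab *.
  have : (k * (a + 5) <= k * (4 * l + 5))%N by rewrite leq_mul2l; lia.
  set u := (k * (4 * l + 5))%N => h.
  have : (L * (7 + u) <= l * (7 + u))%N by rewrite leq_mul2r Ll orbT.
  have : (L * (7 + k * (a + 5)) <= L * (7 + u))%N by rewrite leq_mul2l; lia.
  by have := mulnDr L 7 (k * (a + 5)); nia.
have wri : (write_time k l L <= 3 + l * (4 + k * (4 * l + 6)))%N.
  rewrite /write_time /for_time; set a := label_time _ in lab *.
  have : (k * (a + 6) <= k * (4 * l + 6))%N by rewrite leq_mul2l; lia.
  set u := (k * (4 * l + 6))%N => h.
  have : (l * (4 + k * (a + 6)) <= l * (4 + u))%N by rewrite leq_mul2l; lia.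
  by nia.
have nxt : (next_time L <= 3 * l)%N by rewrite /next_time; lia.
(* [k + 1 <= 2 k] trades the base [k + 1] for [k] at the price of [2^l]. *)
have pw : (k.+1 ^ L.-1 <= 2 ^ l * k ^ l)%N.
  rewrite -expnMn; apply: (@leq_trans (k.+1 ^ l)).
    by apply: leq_pexp2l => //; lia.
  by rewrite leq_exp2r; lia.
rewrite /loop_time /level_time.
set body := (value_time k L + _).+1; set w := (k.+1 ^ L.-1)%N in pw *.
have bodyE : (body <= 42 * (k * l ^ 2))%N.
  rewrite /body; move: val wri nxt.
  move: (value_time _ _) (write_time _ _ _) (next_time _) => v r x.
  by rewrite expnS expn1; nia.
have : (w * body <= (2 ^ l * k ^ l) * (42 * (k * l ^ 2)))%N by exact: leq_mul.
have : (0 < 2 ^ l * k ^ l)%N by rewrite muln_gt0 !expn_gt0 k0.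
have -> : (60 * (k * k ^ l) * (l ^ 2 * 2 ^ l) =
  (2 ^ l * k ^ l) * (60 * (k * l ^ 2)))%N by nia.
move: (2 ^ l * k ^ l)%N (w * body)%N => c u; rewrite expnS expn1 => c0 uc.
have : (l * 1 <= l * l * k)%N by nia.
by move: (l * l)%N uc => ll uc; nia.
Qed.

Lemma search_time_poly (R : realType) (k l t : nat) :
  (0 < k)%N -> (1 < l)%N ->
  (t <= 60 * (k * k ^ l) * (l ^ 2 * 2 ^ l))%N ->
  t%:R <= 60 * ((k ^ (l ^ 2))%:R : R) ^+ 2 *
          (2 `^ (l%:R ^+ 3 * ln l%:R)) ^+ 3.
Proof.
move=> k0 l1 tle; set Z := 2 `^ _.
(* [l <= l^3 ln l], since [l >= 2] and [ln l >= 1/2]. So [2^l] and [l] are both at most [Z], and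
   [l^2 * 2^l] is at most [Z^3]. *)
have Zl : (2 ^ l)%:R <= Z :> R.
  rewrite natrX -powR_mulrn //; apply: ler_powR; first by rewrite ler1n.
  have l2 : 2 <= l%:R :> R by rewrite ler_nat.
  have ln2 : 2^-1 <= ln (l%:R : R).
    have := trunc_log_ln R (ltnW l1); have : (1 <= trunc_log 2 l)%N.
      by apply: trunc_log_max.
    by rewrite -(ler_nat R); lra.
  have l4 : 4 <= l%:R ^+ 2 :> R by nra.
  have : 4 * 2^-1 <= l%:R ^+ 2 * ln l%:R :> R by apply: ler_pM; lra.
  by rewrite exprS -mulrA; nra.
have Zl1 : l%:R <= Z.
  by apply: le_trans Zl; rewrite ler_nat ltnW // ltn_expl.
have K1 : (k <= k ^ (l ^ 2))%N.
  by rewrite -[leqLHS]expn1; apply: leq_pexp2l => //; rewrite expn_gt0; lia.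
have K2 : (k ^ l <= k ^ (l ^ 2))%N.
  by apply: leq_pexp2l => //; rewrite expnS expn1; nia.
apply: (@le_trans _ _ (60 * (k * k ^ l) * (l ^ 2 * 2 ^ l))%:R).
  by rewrite ler_nat.
rewrite natrM (natrM _ 60); apply: ler_pM; rewrite ?mulr_ge0 //.
  by rewrite ler_pM2l // -natrX ler_nat -mulnn; apply: leq_mul.
rewrite natrM natrX [leRHS]exprSr; apply: ler_pM; rewrite ?exprn_ge0 //.
by rewrite ler_sqr ?nnegrE // (le_trans _ Zl1).
Qed.

(** * The whole search, and the sample complexity of its output *)

Lemma runs_search (R : realType) (k l : nat) (p q : 'I_k -> R) (eps : R) :
  is_dist p -> is_dist q -> 0 < eps -> (0 < k)%N -> (1 < l)%N ->
  let E := expR eps - 1 in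
  runs search_prog (60 * (k * k ^ l) * (l ^ 2 * 2 ^ l))
    (fun s => exists L d, [/\ level_spec E l L,
       forall i, (i < L.-1)%N -> (d i <= k)%N,
       forall e, (forall i, (i < L.-1)%N -> (e i <= k)%N) ->
         value p q E L (fun x => label p q L.-1 e x) <=
         value p q E L (fun x => label p q L.-1 d x)
     & forall (y : 'I_l) (x : 'I_k), output_channel s y x =
         rand_resp E L y (label p q L.-1 d x)]) (input_state l p q eps).
Proof.
move=> dp dq eps0 k0 l1 E.
have E0 : 0 < E by rewrite subr_gt0 expR_gt1.
have E1 : expR eps = 1 + E by rewrite /E addrC subrK.
pose B := (60 * (k * k ^ l) * (l ^ 2 * 2 ^ l) - level_time l)%N.
have LB : (level_time l <= 60 * (k * k ^ l) * (l ^ 2 * 2 ^ l))%N.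
  by apply: leq_trans (search_time_le k0 (ltnW l1) (leqnn l)); exact: leq_addr.
rewrite -(subnKC LB); apply: runs_seq.
apply: runs_le (runs_level (s := input_state l p q eps) l1 E0 _ _)
  (leqnn _) _ => // s1 [fr [L [Lspec sL sLR]]].
have [L1 Ll _ _] := Lspec.
have Es : env l L p q E s1.
  by split; rewrite ?sL ?fr.1 //; split; rewrite ?sLR ?fr.2.
apply: runs_le (runs_loop dp dq E0 k0 L1 Es _ _) _ _.
- by rewrite fr.1.
- by rewrite fr.2.
- by have := search_time_le k0 (ltnW L1) Ll; lia.
move=> s2 [d [dd best out]]; exists L, d; split=> // y x.
exact: out.
Qed.

Theorem corollary1p20 (R : realType) :
  exists (algo : prog) (P : {poly {poly R}}) (c C D : R),
    [/\ 0 < c, 0 < C & 0 < D] /\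
    forall (k : nat) (p q : 'I_k -> R) (eps : R) (l : nat),
      is_dist p -> is_dist q -> 0 < eps -> (1 < l)%N ->
      exists (t : nat) (s : state R),
        [/\ exec algo (input_state l p q eps) t s,
            t%:R <= P.[((k ^ (l ^ 2))%:R)%:P].[2 `^ (l%:R ^+ 3 * ln l%:R)]
          & let T : 'I_l -> 'I_k -> R := output_channel s in
            let N := sample_complexity [set T] p q in
            [/\ is_channel T /\ is_ldp eps T,
                (c%:E * nstar_comm p q eps l <= N
                   <= C%:E * nstar_comm p q eps l)%E,
                (N <= D%:E * (nstar p q eps *
                         (1 + lne (nstar p q eps) * (l%:R^-1)%:E)))%E
              & exists (f : 'I_k -> 'I_(2 * l ^ 2))
                       (S : 'I_l -> 'I_(2 * l ^ 2) -> R),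
                  [/\ is_threshold p q f,
                      is_channel S /\ is_ldp eps S
                    & forall y x, T y x = S y (f x)]]].
Proof.
(* The time bound is [60 X^2 Y^3]. The constant 1 is right because [T] is itself admissible; 38
   comes from [sample_complexity_le], and [128 = 2 * 64], [4096 = 2 * 32 * 64], with 64 the loss of
   [best_threshold] and 32 that of [quantize]. *)
exists search_prog, ((60%:P * 'X^3)%:P * 'X^2), 1, (38 * 128), (38 * 4096).
have C_gt0 : 0 < 38 * 128 :> R by rewrite mulr_gt0 ?ltr0n.
have D_gt0 : 0 < 38 * 4096 :> R by rewrite mulr_gt0 ?ltr0n.
split; first by split; [exact: ltr01|exact: C_gt0|exact: D_gt0].
move=> k p q eps l dp dq eps0 l1.
have k0 : (0 < k)%N.
  case: (k) p q dp dq => // p q [_ p1] _; move: p1.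
  by rewrite big_ord0 => /eqP; rewrite eq_sym oner_eq0.
have [t [s [ex tle [L [d [Lspec dd best out]]]]]] :=
  runs_search dp dq eps0 k0 l1.
exists t, s; split=> //.
  apply: le_trans (@search_time_poly R _ _ _ k0 l1 tle) _.
  rewrite !hornerE /= le_eqVlt; apply/orP; left; apply/eqP; ring.
set E := expR eps - 1 in Lspec best out.
have E0 : 0 < E by rewrite subr_gt0 expR_gt1.
have E1 : expR eps = 1 + E by rewrite /E addrC subrK.
have [L1 Ll _ _] := Lspec; have L0 := ltnW L1.
pose lab (x : 'I_k) := label p q L.-1 d x.
have labL x : (lab x < L)%N.
  by apply: leq_ltn_trans (label_le _ _ _ _ _) _; rewrite prednK.
move=> T N.
have TE : T = fun (y : 'I_l) x => rand_resp E L y (lab x).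
  by apply: funext => y; apply: funext => x; exact: out.
have chT : is_channel T by rewrite TE; exact: rand_resp_channel.
have ldpT : is_ldp eps T.
  by move=> x x' y; rewrite TE E1; exact: rand_resp_ldp.
pose v := \sum_y lecam (output_law p T y) (output_law q T y).
have vE : v = E ^+ 2 / (L%:R + E) * value p q E L lab.
  by rewrite /v TE lecam_rand_resp.
(* The search maximizes over all digit tuples, so [v] is at least what the tuple provided by
   [best_threshold] achieves. *)
have opt (T' : 'I_l -> 'I_k -> R) :
    (forall y x, 0 <= T' y x) -> (forall x, \sum_y T' y x <= 1) ->
    is_ldp eps T' ->
    \sum_y lecam (output_law p T' y) (output_law q T' y) <= 64 * v.
  rewrite /is_ldp E1 => T'0 T'1 ldpT'.
  have [e ek he] := best_threshold dp dq E0 Lspec T'0 T'1 ldpT'.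
  apply: le_trans he _; rewrite ler_pM2l // vE; apply: ler_wpM2l.
    by rewrite divr_ge0 ?sqr_ge0 // addr_ge0 ?(ltW E0).
  by apply: best => i _; exact: ek.
have upper a : 0 < a -> a <= v -> (N <= (38 / a)%:E)%E.
  move=> a0 av; apply: le_trans (sample_complexity_le dp dq chT _) _.
    exact: lt_le_trans av.
  by rewrite lee_fin ler_pM2l // lef_pV2 ?posrE // (lt_le_trans a0).
split=> //.
- rewrite mul1e; apply/andP; split.
    apply: ereal_inf_le_tmp => _ [n [T1 [CT tst]] <-]; exists n => //.
    by exists T1; split=> // i; rewrite CT.
  rewrite /nstar_comm; have [->|[n tn ->]] := sample_complexity_cases
      (@ldp_channels R 'I_k 'I_l eps) p q.
    by rewrite gt0_muley ?lte_fin // leey.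
  have [n0 [T' [chT' ldpT' [F hF]]]] := testable_ldp_lecam dp dq tn.
  have n0R : 0 < n%:R :> R by rewrite ltr0n.
  have hv : (2 * n%:R)^-1 <= 64 * v.
    apply: le_trans hF (le_trans _ (opt T' chT'.1 _ ldpT')).
      rewrite -[leRHS]big_enum /=; apply: ler_sum_subseq => //.
      - exact: fset_uniq.
      - exact: enum_uniq.
      - by move=> y _; rewrite mem_enum.
      move=> y; apply: lecam_ge0; apply: output_law_ge0 => x;
        by rewrite ?dp.1 ?dq.1 ?chT'.1.
    by move=> x; rewrite sum_channel.
  apply: le_trans (upper (128 * n%:R)^-1 _ _) _.
  + by rewrite invr_gt0 mulr_gt0 ?ltr0n.
  + have -> : (128 * n%:R)^-1 = (2 * n%:R)^-1 / 64 :> R.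
      by field; rewrite gt_eqF.
    by rewrite ler_pdivrMr ?ltr0n // [v * _]mulrC.
  rewrite -EFinM lee_fin invrK mulrA; exact: lexx.
(* If [nstar] is infinite, so is the right side. Otherwise one user of an optimal protocol has a
   channel worth quantizing to [l] outputs. *)
- rewrite /nstar; have [->|[n tn ->]] := sample_complexity_cases
      (@ldp_channels R 'I_k nat eps) p q.
    have -> : lne (+oo%E : \bar R) = +oo%E by [].
    have linv_gt0 : (0 < (l%:R^-1 : R)%:E)%E.
      by rewrite lte_fin invr_gt0 ltr0n ltnW.
    rewrite (gt0_mulye linv_gt0) addey // gt0_mulye //.
    by rewrite gt0_muley ?leey ?lte_fin.
  have [n0 [T' [chT' ldpT' [F hF]]]] := testable_ldp_lecam dp dq tn.
  have n0R : 0 < n%:R :> R by rewrite ltr0n.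
  have [T2 [T20 T21 T2ldp hT2]] := quantize dp dq l1 n0 chT'.1
    (fun x => sum_fset_channel_le1 F x chT') ldpT' hF.
  rewrite lne_EFin //; set u := 1 + ln n%:R / l%:R in hT2 *.
  have -> : (1 + (ln n%:R)%:E * (l%:R^-1)%:E = u%:E)%E by [].
  rewrite -!EFinM.
  have u0 : 0 < u.
    by rewrite ltr_pwDl // divr_ge0 // ln_ge0 // ler1n.
  have hv : (2 * n%:R)^-1 <= 2048 * u * v.
    apply: le_trans hT2 _; have := opt T2 T20 T21 T2ldp.
    by move: (\sum_y _) => w; nra.
  apply: le_trans (upper (4096 * n%:R * u)^-1 _ _) _.
  + by rewrite invr_gt0 !mulr_gt0 ?ltr0n.
  + have -> : (4096 * n%:R * u)^-1 = (2 * n%:R)^-1 / (2048 * u) :> R.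
      by field; rewrite !gt_eqF.
    have c_gt0 : 0 < 2048 * u by rewrite mulr_gt0 ?ltr0n.
    rewrite ler_pdivrMr; last exact: c_gt0.
    by rewrite [v * _]mulrC; exact: hv.
  rewrite lee_fin invrK !mulrA; exact: lexx.
have bound x : (lab x < 2 * l ^ 2)%N.
  apply: leq_trans (labL x) _; apply: leq_trans Ll _.
  by rewrite expnS expn1; nia.
exists (fun x => Ordinal (bound x)).
(* [minn] folds the larger domain into the [L] labels, which makes [S] a channel on all of it, and
   fixes every label taken by [f]. *)
exists (fun y j => rand_resp E L y (minn j L.-1)).
split.
- exact: (@label_threshold _ _ L.-1 _ _ _ d).
- split.
    by apply: rand_resp_channel => // x; rewrite gtn_min prednK ?leqnn ?orbT.
  by move=> x x' y; rewrite E1; exact: rand_resp_ldp.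
- move=> y x; rewrite TE /=; congr (rand_resp _ _ _ _).
  by apply/esym/minn_idPl; exact: label_le.
Qed.
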